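(* Let $F=\mathbb{F}_{q^n}(x,y)$ be the linearized function field defined by $L(y)=f(x)/g(x)$ as in the context, and consider the divisor $G:=\sum_{i=1}^s a_iQ_i+b_\infty Q_\infty$ of $F$, where $a_1,\ldots,a_s,b_\infty\in\mathbb{Z}$. Then the set $S$ of all functions $$y^k x^{e_{\infty,k}}\prod_{i=1}^s p_i^{e_{i,k}},$$ where $k$ ranges over all integers with $0\leq k\leq q^r-1$ and $e_{\infty,k},e_{1,k},\ldots,e_{s,k}$ range over all integers satisfying $e_{\infty,k}\geq 0$, $$-a_i\leq -kn_i+q^re_{i,k}\quad\text{for all }1\leq i\leq s,$$ and $$k(\deg f-\deg g)+q^r\left(e_{\infty,k}+\sum_{i=1}^s e_{i,k}\deg p_i\right)\leq b_\infty,$$ is a generating set of $\mathcal{L}(G)$ as a vector space over $\mathbb{F}_{q^n}$.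
   Context: A linearized function field is a function field $F=\mathbb{F}_{q^n}(x,y)$, with $x$ transcendental over $\mathbb{F}_{q^n}$, defined by an equation $L(y)=h(x):=\frac{f(x)}{g(x)}$, where $L(y)=\sum_{i=0}^r\lambda_iy^{q^i}\in\mathbb{F}_{q^n}[y]$ is a linearized polynomial with $\lambda_r,\lambda_0\neq0$ having $q^r$ roots in $\mathbb{F}_{q^n}$, and $f,g\in\mathbb{F}_{q^n}[x]$ are coprime polynomials whose factorizations into (pairwise distinct) irreducibles are $f=\prod_{j=1}^m q_j^{m_j}$ and $g=\prod_{i=1}^s p_i^{n_i}$. It is assumed that $d:=\deg f-\deg g>0$ and that the positive integers $n_1,\ldots,n_s$ and $d$ are each coprime to the characteristic of $\mathbb{F}_q$. The zeros $P_1,\ldots,P_s$ of $p_1,\ldots,p_s$ and the pole $P_\infty$ of $x$ in $\mathbb{F}_{q^n}(x)$ are totally ramified in $F/\mathbb{F}_{q^n}(x)$. $Q_i$ denotes the only zero of $p_i$ in $F$ ($1\leq i\leq s$) and $Q_\infty$ the only pole of $x$ in $F$. For a divisor $G$ of $F$, $\mathcal{L}(G)=\{z\in F\setminus\{0\} : (z)\geq-G\}\cup\{0\}$ is the Riemann--Roch space, a finite-dimensional $\mathbb{F}_{q^n}$-vector space. *)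

(* Defs.v *)
From HB Require Import structures.
From mathcomp Require Import all_boot all_order all_algebra all_field.
From mathcomp Require Import boolp classical_sets.
From mathcomp Require Import freeg.

Set Implicit Arguments.
Unset Strict Implicit.
Unset Printing Implicit Defensive.

Import GRing.Theory Num.Theory.
Local Open Scope ring_scope.

Section FunctionField.
Variables (K : finFieldType) (F : fieldExtType {fraction {poly K}}).

(* F is a finite extension of the rational function field K(x), so x is
   transcendental over K by construction.  [polyF p] is p(x), as an element
   of F. *)
Definition polyF (p : {poly K}) : F := (tofrac p)%:A.
Definition constF (c : K) : F := polyF c%:P.
Definition xF : F := polyF 'X.

(* The places of F/K, each given by its normalized discrete valuation.  The
   value at 0 should be +oo; it is replaced by the dummy value 0, and [placeD]
   excludes it.  Fixing it makes two places equal as soon as their valuations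
   agree on the nonzero elements of F. *)
Record place := Place {
  pval :> F -> int;
  place0 : pval 0 = 0;
  placeM : forall u v : F, u != 0 -> v != 0 -> pval (u * v) = pval u + pval v;
  placeD : forall u v : F, u != 0 -> v != 0 -> u + v != 0 ->
             Order.min (pval u) (pval v) <= pval (u + v);
  placeC : forall c : K, c != 0 -> pval (constF c) = 0;
  place_uniformizer : exists t : F, pval t = 1 }.

HB.instance Definition _ := gen_eqMixin place.
HB.instance Definition _ := gen_choiceMixin place.

Definition is_zero (z : F) (P : place) : Prop := z != 0 /\ 0 < P z.
Definition is_pole (z : F) (P : place) : Prop := z != 0 /\ P z < 0.

Definition divisor := {freeg place / int}.

Definition RRspace (G : divisor) : set F :=
  [set z : F | z != 0 -> forall P : place, - coeff P G <= P z]%classic.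

Definition Kspan (S : set F) : set F :=
  [set z : F | exists (l : nat) (c : 'I_l -> K) (w : 'I_l -> F),
     (forall i, S (w i)) /\ z = \sum_(i < l) constF (c i) * w i]%classic.

End FunctionField.

Arguments polyF {K} F p.
Arguments constF {K} F c.
Arguments xF {K} F.

Definition degp (K : finFieldType) (p : {poly K}) : nat := (size p).-1.

Definition linearized (K : finFieldType) (q r : nat) (lam : 'I_r.+1 -> K) :
  {poly K} := \sum_(i < r.+1) lam i *: 'X^(q ^ i)%N.

(* Main.v *)
Require Import Defs.
From HB Require Import structures.
From mathcomp Require Import all_boot all_order all_algebra all_field.
From mathcomp Require Import boolp classical_sets.
From mathcomp Require Import freeg.
From mathcomp Require Import zify ring.

(** Write z in F as a sum of terms c_k y^k with k < q^r and c_k in K(x).  The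
    theorem says that if z lies in L(G) then so does each monomial of each term,
    and this is a statement about places.

    At Q_i, comparing values in L(y) = f/g gives q^r v(y) = - n_i v(p_i).  As n_i
    is prime to q, v(p_i) is divisible by q^r, and the values of the terms
    c_k y^k are pairwise distinct; the same holds at Q_oo, with 1/x for p_i and
    deg f - deg g for n_i.  Hence v(z) is the least of the values of the terms:
    the bounds imposed by G on z are bounds on each term (ramified_sum).  It
    also follows that v(p_i) = q^r, as v is normalized (ramified_index), that
    Q_i is the only place above p_i (ramified_unique), and that the powers
    y^k, k < q^r, are independent over K(x).

    Let now p be a prime of K[x] that does not divide g.  Over an algebraic
    closure k of K, take a root x0 of p.  As L'(Y) is a nonzero constant, each
    solution eta of L(eta) = f(x0)/g(x0) lifts by Newton iteration to a power
    series in X - x0, and F embeds in the field of Laurent series over k.  The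
    order of vanishing, suitably normalized, is a place of F above p.  Only the
    approximations of the power series modulo powers of X - x0 are used: the
    order of vanishing is their common order from some point on
    (place_of_point).  There are q^r such points (x0, eta), since the roots of L
    lie in K.  If z is regular at the corresponding places and w is a common
    denominator of the c_k, divisible by p, then the polynomial in Y with
    coefficients (w c_k)(x0), which has degree less than q^r, vanishes at q^r
    points, so p divides all the w c_k and can be cancelled
    (unramified_integral).  Therefore the denominators of the c_k only contain
    the primes p_i.

    Each c_k is thus a polynomial in x prime to the p_i, times a product of
    powers of the p_i with exponents e_i in Z.  The values of c_k y^k at Q_i and
    Q_oo are then explicit, and the bounds on them are the conditions that
    define S.  Conversely these conditions say that the elements of S satisfy the
    bounds at the Q_i and at Q_oo; at the other places x and y are regular and
    the p_i are units (unramified_place). *)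

Set Implicit Arguments.
Unset Strict Implicit.
Unset Printing Implicit Defensive.

Import Order.TTheory GRing.Theory Num.Theory.
Local Open Scope ring_scope.

(** * Prime factors of polynomials *)

Lemma divp_irreducible (k : fieldType) (p u : {poly k}) :
  irreducible_poly p -> u != 0 -> p %| u ->
  u %/ p != 0 /\ (size (u %/ p)%R < size u)%N.
Proof.
move=> irr u0 pu; split.
  by apply: contraNneq u0 => d0; rewrite -(divpK pu) d0 mul0r.
rewrite size_divp ?irredp_neq0 //; case: irr => sp _.
by rewrite ltn_subrL -subn1 subn_gt0 sp size_poly_gt0.
Qed.

Lemma irreducible_factor (k : fieldType) (u : {poly k}) : (1 < size u)%N ->
  exists2 p, irreducible_poly p & p %| u.
Proof.
have [n] := ubnP (size u); elim: n u => // n IHn u szn sz1.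
have [irr|nirr] := pselect (irreducible_poly u); first by exists u.
have [v [v1 vu nvu]] : exists v : {poly k}, [/\ size v != 1%N, v %| u & ~ v %= u].
  apply: contrapT => nv; apply: nirr; split=> // v v1 vu.
  by apply: contrapT => nvu; apply: nv; exists v.
have u0 : u != 0 by rewrite -size_poly_gt0 ltnW.
have v0 : v != 0 by apply: contraNneq u0 => v0; rewrite v0 dvd0p in vu.
have [p pirr pv] : exists2 p, irreducible_poly p & p %| v.
  apply: IHn; last by rewrite ltn_neqAle eq_sym v1 size_poly_gt0.
  rewrite -ltnS (leq_trans _ szn) // ltnS ltn_neqAle dvdp_leq // andbT.
  by apply: contra_notN nvu; rewrite dvdp_size_eqp.
by exists p => //; apply: dvdp_trans pv vu.
Qed.

(** Stripping the primes pg i off u leaves a cofactor prime to all of them.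
Applied to a numerator, the exponents become the valuations at the pg i. *)
Lemma factor_out (k : fieldType) (s : nat) (pg : 'I_s -> {poly k}) (u : {poly k}) :
  (forall i, irreducible_poly (pg i)) -> u != 0 ->
  exists (v : {poly k}) (l : 'I_s -> nat),
  [/\ v != 0, u = v * \prod_i pg i ^+ l i & forall i, coprimep (pg i) v].
Proof.
move=> irr; have [n] := ubnP (size u); elim: n u => // n IHn u szu u0.
have [[i piu]|npu] := pselect (exists i, pg i %| u); last first.
  exists u, (fun=> 0%N); split=> // [|i]; first by rewrite big1 ?mulr1.
  by rewrite irreducible_poly_coprime //; apply/negP => piu; apply: npu; exists i.
have uE := divpK piu; have [d0 szd] := divp_irreducible (irr i) u0 piu.
have [v [l [v0 dE cop]]] := IHn (u %/ pg i) (leq_trans szd szu) d0.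
exists v, (fun j => l j + (j == i))%N; split=> //.
rewrite -uE dE -mulrA; congr (_ * _).
under [RHS]eq_bigr do rewrite exprD.
rewrite big_split /=; congr (_ * _).
by rewrite (bigD1 i) //= eqxx expr1 big1 ?mulr1 // => j /negPf->.
Qed.

(** * Places and their values on K[x] *)

Section PolyF.
Variables (K : finFieldType) (F : fieldExtType {fraction {poly K}}).

Fact polyF_zmod : zmod_morphism (polyF F).
Proof. by move=> u v; rewrite /polyF rmorphB /= scalerBl. Qed.
Fact polyF_monoid : monoid_morphism (polyF F).
Proof.
split=> [|u v]; first by rewrite /polyF rmorph1 scale1r.
by rewrite /polyF rmorphM /= -scalerAl mul1r scalerA.
Qed.
HB.instance Definition _ :=
  GRing.isZmodMorphism.Build {poly K} F (polyF F) polyF_zmod.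
HB.instance Definition _ :=
  GRing.isMonoidMorphism.Build {poly K} F (polyF F) polyF_monoid.

Lemma polyF_eq0 u : (polyF F u == 0) = (u == 0).
Proof. by rewrite /polyF scaler_eq0 oner_eq0 orbF tofrac_eq0. Qed.

HB.instance Definition _ := GRing.RMorphism.copy (constF F)
  (polyF F \o polyC).

Lemma constF_eq0 c : (constF F c == 0) = (c == 0).
Proof. by rewrite /constF polyF_eq0 polyC_eq0. Qed.

Lemma xF_neq0 : xF F != 0.
Proof. by rewrite /xF polyF_eq0 polyX_eq0. Qed.

Lemma polyF_coef (u : {poly K}) :
  polyF F u = \sum_(i < size u) constF F u`_i * xF F ^+ i.
Proof.
rewrite -{1}(coefK u) poly_def rmorph_sum; apply: eq_bigr => i _.
by rewrite -mul_polyC rmorphM rmorphXn.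
Qed.
End PolyF.

Section Place.
Variables (K : finFieldType) (F : fieldExtType {fraction {poly K}}).
Variable P : place F.
Implicit Types (u v z : F) (m n : int).

Lemma place1 : P 1 = 0.
Proof. by have := placeC P (oner_neq0 K); rewrite rmorph1. Qed.

Lemma placeV u : P u^-1 = - P u.
Proof.
have [->|u0] := eqVneq u 0; first by rewrite invr0 place0 oppr0.
have uV0 : u^-1 != 0 by rewrite invr_eq0.
by apply/eqP; rewrite -addr_eq0 -placeM // mulVf // place1.
Qed.

Lemma placeN u : P (- u) = P u.
Proof.
have [->|u0] := eqVneq u 0; first by rewrite oppr0.
rewrite -mulN1r placeM ?oppr_eq0 ?oner_neq0 //.
have /(placeC P) : (-1 : K) != 0 by rewrite oppr_eq0 oner_eq0.
by rewrite rmorphN rmorph1 => ->; rewrite add0r.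
Qed.

Lemma placeX u k : P (u ^+ k) = k%:Z * P u.
Proof.
have [->|u0] := eqVneq u 0.
  by rewrite expr0n; case: k => [|k]; rewrite /= ?place1 place0 ?mulr0.
elim: k => [|k IHk]; first by rewrite expr0 place1 mul0r.
by rewrite exprS placeM ?expf_neq0 // IHk -addn1 PoszD mulrDl mul1r addrC.
Qed.

Lemma placeXz u (k : int) : P (u ^ k) = k * P u.
Proof.
by case: k => k; rewrite ?NegzE -?exprnN ?placeV -?exprnP placeX // mulNr.
Qed.

Lemma place_prod I (s : seq I) (p : pred I) (u : I -> F) :
  (forall i, p i -> u i != 0) ->
  P (\prod_(i <- s | p i) u i) = \sum_(i <- s | p i) P (u i).
Proof.
move=> u0.
suff [] : \prod_(i <- s | p i) u i != 0 /\
   P (\prod_(i <- s | p i) u i) = \sum_(i <- s | p i) P (u i) by [].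
elim/big_rec2: _ => [|i a b /u0 ui0 [b0 <-]]; first by rewrite oner_neq0 place1.
by rewrite mulf_neq0 // placeM.
Qed.

(** Places carry the dummy value 0 at 0, so the statement P z >= m is the wrong
bound at z = 0; this predicate treats 0 as having infinite value, which makes
it stable under addition without nonvanishing side conditions. *)
Definition vge m z := (z == 0) || (m <= P z).

Lemma vge0 m : vge m 0. Proof. by rewrite /vge eqxx. Qed.

Lemma vgeD m u v : vge m u -> vge m v -> vge m (u + v).
Proof.
rewrite /vge.
have [->|u0] := eqVneq u 0; first by rewrite add0r.
have [->|v0] := eqVneq v 0; first by rewrite addr0 (negbTE u0).
have [//|w0 /= mu mv] := eqVneq (u + v) 0.
by apply: le_trans (placeD P u0 v0 w0); rewrite le_min mu mv.
Qed.

Lemma vge_sum I (s : seq I) (p : pred I) m (u : I -> F) :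
  (forall i, p i -> vge m (u i)) -> vge m (\sum_(i <- s | p i) u i).
Proof. by move=> mu; elim/big_ind: _ => [||//]; [apply: vge0|apply: vgeD]. Qed.

Lemma vgeM m n u v : vge m u -> vge n v -> vge (m + n) (u * v).
Proof.
rewrite /vge mulf_eq0; have [//|u0] := eqVneq u 0; have [//|v0 /=] := eqVneq v 0.
by rewrite placeM //; apply: lerD.
Qed.

Lemma vge_const c : vge 0 (constF F c).
Proof.
by rewrite /vge constF_eq0; have [//|c0] := eqVneq c 0; rewrite placeC ?lexx.
Qed.

(** The strict case of the triangle inequality: the summand of least value
decides the value of the sum, for otherwise u = (u + v) - v would have too
large a value. *)
Lemma place_dominated u v : u != 0 -> vge (P u + 1) v ->
  u + v != 0 /\ P (u + v) = P u.
Proof.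
rewrite /vge => u0 /orP[/eqP->|]; first by rewrite addr0.
have [->|v0] := eqVneq v 0; first by rewrite addr0.
move=> uv.
have w0 : u + v != 0.
  apply: contraTN uv; rewrite addr_eq0 => /eqP->; rewrite placeN; lia.
split=> //; have := placeD P u0 v0 w0.
have /(placeD P w0) : - v != 0 by rewrite oppr_eq0.
rewrite addrK placeN => /(_ u0); lia.
Qed.

(** Terms with pairwise distinct values cannot cancel: the unique term of least
value dominates the sum of all the others. *)
Lemma place_sum_distinct (I : finType) (u : I -> F) (i0 : I) :
  u i0 != 0 ->
  (forall i j, u i != 0 -> u j != 0 -> P (u i) = P (u j) -> i = j) ->
  [/\ \sum_i u i != 0,
      forall i, u i != 0 -> P (\sum_i u i) <= P (u i)
    & exists2 i, u i != 0 & P (\sum_i u i) = P (u i)].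
Proof.
move=> ui0 dist.
have [k uk mink] := @arg_minP _ _ _ i0 (fun i => u i != 0) (fun i => P (u i)) ui0.
have rest : vge (P (u k) + 1) (\sum_(i | i != k) u i).
  apply: vge_sum => i ik; rewrite /vge; case: eqVneq => //= ui.
  have := mink i ui; rewrite le_eqVlt => /orP[/eqP|].
    by move/(dist _ _ uk ui) => ki; rewrite ki eqxx in ik.
  lia.
have [s0 sP] := place_dominated uk rest.
rewrite (bigD1 k) //=; split=> //.
  by move=> i ui; rewrite sP mink.
by exists k.
Qed.

Section BaseValues.

Lemma vge_poly (u : {poly K}) : 0 <= P (xF F) -> vge 0 (polyF F u).
Proof.
move=> x0; rewrite polyF_coef; apply: vge_sum => i _.
rewrite -[0]addr0; apply: vgeM; first exact: vge_const.
by rewrite /vge placeX mulr_ge0 ?orbT.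
Qed.

Lemma place_poly_ge0 (u : {poly K}) : 0 <= P (xF F) -> 0 <= P (polyF F u).
Proof. by move/(vge_poly u)/orP=> [/eqP->|//]; rewrite place0. Qed.

(** At a pole of x the monomials of u have pairwise distinct values, so the
leading one decides. *)
Lemma place_poly_pole (u : {poly K}) : P (xF F) < 0 ->
  P (polyF F u) = (degp u)%:Z * P (xF F).
Proof.
move=> x0; have [->|u0] := eqVneq u 0.
  by rewrite rmorph0 place0 /degp size_poly0 mul0r.
have szu : (0 < size u)%N by rewrite size_poly_gt0.
pose t (i : 'I_(size u)) := constF F u`_i * xF F ^+ i.
have tP i : t i != 0 -> P (t i) = i%:Z * P (xF F).
  rewrite mulf_eq0 negb_or => /andP[c0 xi0].
  by rewrite placeM // placeX placeC ?add0r // -(constF_eq0 F).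
have top : ((size u).-1 < size u)%N by rewrite prednK.
have ttop : t (Ordinal top) != 0.
  by rewrite mulf_neq0 ?expf_neq0 ?xF_neq0 // constF_eq0 /= -lead_coefE
    lead_coef_eq0.
have [|_ /(_ _ ttop) le1 [i ti Pi]] := place_sum_distinct ttop.
  move=> i j ti tj; rewrite !tP // => /mulIf; rewrite lt_eqF // => /(_ isT) [ij].
  exact: val_inj.
move: le1; rewrite polyF_coef Pi tP // (tP _ ttop) /= /degp.
rewrite ler_nM2r // => le1; congr (_ * _).
have := ltn_ord i; move: (nat_of_ord i) le1 => k; rewrite lez_nat => a b; congr
  Posz.
  by apply/eqP; rewrite eqn_leq a -ltnS prednK // b.
Qed.

Lemma place_xF_ge0 (u : {poly K}) : 0 < P (polyF F u) -> 0 <= P (xF F).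
Proof.
move=> Pu; case: (lerP 0 (P (xF F))) => // xneg.
by move: Pu; rewrite place_poly_pole //; nia.
Qed.

(** A Bezout relation between u and v would give 1 a positive value if v also
vanished at P. *)
Lemma place_coprime (u v : {poly K}) : 0 < P (polyF F u) -> coprimep u v ->
  P (polyF F v) = 0.
Proof.
move=> Pu /Bezout_eq1_coprimepP [[a b] /= ab1].
have Px := place_xF_ge0 Pu; apply/eqP; apply: contraTT isT => Pv.
have {}Pv : 0 < P (polyF F v) by rewrite lt_neqAle eq_sym Pv place_poly_ge0.
have : vge 1 1.
  rewrite -(rmorph1 (polyF F)) -ab1 rmorphD !rmorphM /=.
  by apply: vgeD; rewrite -[1]add0r; apply: vgeM; rewrite ?vge_poly // /vge
    -gtz0_ge1;
    apply/orP; right.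
by rewrite /vge oner_eq0 place1.
Qed.
End BaseValues.
End Place.

(** The dummy value at 0 is fixed by the definition of a place, and the other
fields are propositions. *)
Lemma eq_place (K : finFieldType) (F : fieldExtType {fraction {poly K}})
  (P1 P2 : place F) : (forall z, z != 0 -> P1 z = P2 z) -> P1 = P2.
Proof.
move=> eqP12; have : pval P1 = pval P2.
  by apply: funext => z; have [->|/eqP12//] := eqVneq z 0; rewrite !place0.
case: P1 P2 {eqP12} => [v1 ? ? ? ? ?] [v2 ? ? ? ? ?] /= v12.
by subst v2; congr Place; apply: Prop_irrelevance.
Qed.

(** t is a local parameter of a place of K(x): the places P of F with 0 < P t are
those above it, and all of them restrict on K[x] to multiples, with factor P t,
of one and the same function u |-> j.  Uniqueness of a place above a totally
ramified one rests on j not depending on P. *)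
Definition base_param (K : finFieldType) (F : fieldExtType {fraction {poly K}})
  (t : F) :=
  forall u : {poly K}, u != 0 ->
  exists j : int, forall P : place F, 0 < P t -> P (polyF F u) = j * P t.

Lemma base_param_irreducible (K : finFieldType) (F : fieldExtType {fraction {poly
  K}})
  (p : {poly K}) :
  irreducible_poly p -> base_param (polyF F p).
Proof.
move=> irr u; have [n] := ubnP (size u); elim: n u => // n IHn u szu u0.
have [pu|npu] := boolP (p %| u); last first.
  exists 0 => P Pp; rewrite mul0r; apply: place_coprime Pp _.
  by rewrite irreducible_poly_coprime.
have uE := divpK pu; have p0 := irredp_neq0 irr.
have [d0 szd] := divp_irreducible irr u0 pu.
have [j jP] := IHn (u %/ p) (leq_trans szd szu) d0.
exists (j + 1) => P Pp.
by rewrite -uE rmorphM placeM ?polyF_eq0 // jP // mulrDl mul1r.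
Qed.

Lemma base_param_infty (K : finFieldType) (F : fieldExtType {fraction {poly K}}) :
  base_param ((xF F)^-1).
Proof.
move=> u _; exists (- (degp u)%:Z) => P; rewrite placeV oppr_gt0 => Px.
by rewrite place_poly_pole // mulrNN.
Qed.

(** * Normalization and Newton approximation *)

(** The value group of a nonzero valuation is generated by its least positive
value m: the remainder modulo m of any value is a smaller nonnegative value.
Dividing by m therefore yields a normalized valuation. *)
Lemma place_of_valuation (K : finFieldType) (F : fieldExtType {fraction {poly K}})
  (v : F -> int) (u0 : F) :
  (forall u w, u != 0 -> w != 0 -> v (u * w) = v u + v w) ->
  (forall u w, u != 0 -> w != 0 -> u + w != 0 -> Order.min (v u) (v w) <= v (u +
    w)) ->
  (forall c, c != 0 -> v (constF F c) = 0) ->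
  u0 != 0 -> 0 < v u0 ->
  exists2 m : int, 0 < m & exists P : place F, forall z, z != 0 -> v z = m * P z.
Proof.
move=> vM vD vC u0N vu0.
have v1 : v 1 = 0 by have := vC _ (oner_neq0 K); rewrite rmorph1.
have vV u : u != 0 -> v u^-1 = - v u.
  by move=> uN; apply/eqP; rewrite -addr_eq0 -vM ?invr_eq0 // mulVf // v1.
have vX u k : u != 0 -> v (u ^+ k) = k%:Z * v u.
  move=> uN; elim: k => [|k IHk]; first by rewrite expr0 v1 mul0r.
  by rewrite exprS vM ?expf_neq0 // IHk -addn1 PoszD mulrDl mul1r addrC.
have vXz u (k : int) : u != 0 -> v (u ^ k) = k * v u.
  move=> uN; case: k => k; rewrite ?NegzE -?exprnN ?vV ?expf_neq0 // -?exprnP vX //.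
  by rewrite mulNr.
(* k.+1 ranges over the positive values of v, so that ex_minn applies. *)
pose att (k : nat) := `[< exists2 u, u != 0 & v u = k.+1%:Z >].
have exatt : exists k, att k.
  exists `|v u0|.-1%N; apply/asboolP; exists u0 => //.
  by rewrite prednK ?absz_gt0 ?gt_eqF // gtz0_abs.
have [k /asboolP[t tN vt] mink] := ex_minnP exatt.
have dvd z : z != 0 -> (k.+1 %| v z)%Z.
  move=> zN; rewrite dvdzE; apply/eqP.
  have [//|modn0] := eqVneq (`|v z| %% k.+1)%N 0%N.
  pose d := (v z %/ k.+1)%Z; pose z' := z * t ^ (- d).
  have z'N : z' != 0 by rewrite mulf_neq0 // expfz_neq0.
  have vz' : v z' = (v z %% k.+1)%Z.
    by rewrite vM ?expfz_neq0 // vXz // vt /modz mulNr.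
  have vz'0 : (v z %% k.+1)%Z != 0.
    by apply: contra modn0 => /eqP/dvdz_mod0P; rewrite dvdzE.
  have : att `|(v z %% k.+1)%Z|.-1%N.
    apply/asboolP; exists z' => //.
    by rewrite vz' prednK ?absz_gt0 // gez0_abs // modz_ge0.
  move/mink; have := ltz_pmod (v z) (isT : 0 < k.+1%:Z).
  have := modz_ge0 (v z) (isT : k.+1%:Z != 0); move: vz'0; lia.
pose w (z : F) : int := if z == 0 then 0 else (v z %/ k.+1)%Z.
have wE z : z != 0 -> v z = k.+1%:Z * w z.
  by move=> zN; rewrite /w (negbTE zN) mulrC divzK // dvd.
have kN : k.+1%:Z != 0 by [].
exists k.+1%:Z => //.
have w0 : w 0 = 0 by rewrite /w eqxx.
have wM u z : u != 0 -> z != 0 -> w (u * z) = w u + w z.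
  move=> uN zN; apply: (mulfI kN); rewrite mulrDr -!wE ?mulf_neq0 //.
  exact: vM.
have wD u z : u != 0 -> z != 0 -> u + z != 0 -> Order.min (w u) (w z) <= w (u + z).
  move=> uN zN szN; have := vD u z uN zN szN; rewrite !wE //; nia.
have wC c : c != 0 -> w (constF F c) = 0.
  by move=> cN; apply: (mulfI kN); rewrite -wE ?constF_eq0 // vC // mulr0.
have wu : exists z, w z = 1.
  by exists t; apply: (mulfI kN); rewrite -wE // vt mulr1.
by exists (Place w0 wM wD wC wu).
Qed.

Lemma dvdp_sub_horner (k : fieldType) (U : {poly {poly k}}) (a b : {poly k}) :
  a - b %| U.[a] - U.[b].
Proof.
have /factor_theorem[W WE] : root (U - U.[b]%:P) b.
  by rewrite /root !hornerE subrr.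
have -> : U.[a] - U.[b] = W.[a] * (a - b).
  by have := congr1 (horner^~ a) WE; rewrite !hornerE.
exact: dvdp_mull.
Qed.

Section Newton.
Variables (k : fieldType) (q r : nat) (lam : 'I_r.+1 -> k) (f g : {poly k}).
Variables (x0 eta : k).
Hypotheses (q_gt1 : (1 < q)%N) (q_pchar : [pchar k].-nat q).
Hypotheses (lam0 : lam ord0 != 0) (gx0 : g.[x0] != 0).
Hypothesis eta_root : g.[x0] * (\sum_i lam i * eta ^+ (q ^ i)) = f.[x0].
Local Notation T := ('X - x0%:P).

Definition lin (Y : {poly k}) : {poly k} := \sum_i lam i *: Y ^+ (q ^ i).
(** The derivative of g * L(Y) - f in Y is g times the constant term lam ord0 of
L, so Newton iteration may use the constant slope lam ord0 * g.[x0]. *)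
Definition newton_step (Y : {poly k}) :=
  Y - (lam ord0 * g.[x0])^-1 *: (g * lin Y - f).
Definition newton N := iter N newton_step eta%:P.

Lemma linB Y Z : lin (Y - Z) = lin Y - lin Z.
Proof.
rewrite /lin -sumrB; apply: eq_bigr => i _.
have qi : [pchar {poly k}].-nat (q ^ i)%N.
  by rewrite (eq_pnat _ (pchar_poly k)) pnatX q_pchar.
by rewrite -scalerBr exprDn_pchar // exprNn_pchar.
Qed.

(** Additivity of L turns the new error into E - g * L(c E).  The linear term of L
contributes (1 - g / g.[x0]) * E, which gains a factor X - x0, and the other
terms are multiples of E ^ q. *)
Lemma newton_stepP N Y : T ^+ N.+1 %| g * lin Y - f ->
  T ^+ N.+2 %| g * lin (newton_step Y) - f.
Proof.
move=> TE; rewrite /newton_step; set E := g * lin Y - f in TE *; set c := (_ *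
  _)^-1.
have -> : g * lin (Y - c *: E) - f = E - g * lin (c *: E).
  by rewrite linB mulrBr /E addrAC.
rewrite /lin big_ord_recl expn0 expr1 mulrDr opprD addrA.
apply: dvdp_sub; last first.
  apply: dvdp_mull; elim/big_ind: _ => [|u v|i _]; [exact: dvdp0|exact: dvdp_add|].
  rewrite -mul_polyC exprZn -mul_polyC; do 2!apply: dvdp_mull.
  apply: dvdp_trans (dvdp_exp2r _ TE); rewrite -exprM dvdp_exp2l //.
  rewrite (leq_trans _ (leq_mul (leqnn _) (leq_pexp2l (ltnW q_gt1) (_ : 1 <=
    _)%N))) //.
  by rewrite expn1 (leq_trans _ (leq_mul (leqnn _) q_gt1)) //; lia.
have -> : E - g * (lam ord0 *: (c *: E)) = (1 - g.[x0]^-1 *: g) * E.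
  rewrite scalerA /c invfM mulrA divff // mul1r mulrBl mul1r -scalerAl.
  by rewrite -scalerAr.
rewrite exprS; apply: dvdp_mul => //.
by rewrite dvdp_XsubCl /root !hornerE mulVf // subrr.
Qed.

Lemma newton_root N : T ^+ N.+1 %| g * lin (newton N) - f.
Proof.
elim: N => [|N IHN]; last exact: newton_stepP.
rewrite expr1 dvdp_XsubCl /root hornerD hornerN hornerM -eta_root /=.
rewrite /lin horner_sum (eq_bigr (fun i => lam i * eta ^+ (q ^ i))) ?subrr //.
by move=> i _; rewrite hornerZ horner_exp hornerC.
Qed.

Lemma newton_cauchy N M : (N <= M)%N -> T ^+ N.+1 %| newton M - newton N.
Proof.
move=> /subnKC <-; elim: (M - N)%N => [|d IHd]; first by rewrite addn0 subrr dvdp0.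
rewrite addnS /= /newton_step addrAC; apply: dvdp_sub => //.
rewrite -mul_polyC; apply: dvdp_mull.
by apply: dvdp_trans (newton_root _); rewrite dvdp_exp2l // ltnS leq_addr.
Qed.

Lemma horner_newton_cauchy (U : {poly {poly k}}) N M : (N <= M)%N ->
  T ^+ N.+1 %| U.[newton M] - U.[newton N].
Proof.
by move=> /newton_cauchy NM; apply: dvdp_trans NM (dvdp_sub_horner _ _ _).
Qed.

Lemma horner_newton_x0 N : (newton N).[x0] = eta.
Proof.
have := newton_cauchy (leq0n N); rewrite expr1 dvdp_XsubCl /root hornerD hornerN.
by rewrite subr_eq0 /= hornerC => /eqP.
Qed.

(** The order at x0 of a polynomial only depends on the polynomial modulo a higher
power of X - x0; this makes the orders of the successive approximations
stationary. *)
Lemma mup_congr N (u v : {poly k}) : u != 0 -> (mup x0 u <= N)%N ->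
  T ^+ N.+1 %| v - u -> v != 0 /\ mup x0 v = mup x0 u.
Proof.
move=> u0 uN vu.
have du n : (n <= N.+1)%N -> (T ^+ n %| v) = (T ^+ n %| u).
  move=> nN; rewrite -[v](subrK u) dvdp_addr //.
  by apply: dvdp_trans vu; rewrite dvdp_exp2l.
have v0 : v != 0.
  by apply: contraTneq uN => v0; rewrite -ltnNge mup_geq // -du // v0 dvdp0.
split=> //; apply/eqP; rewrite eqn_leq mup_leq // du // -mup_leq // leqnn /=.
by rewrite mup_geq // du ?leqW // -mup_geq.
Qed.
End Newton.

(** * Elements of F as polynomials in x and y *)

Lemma fraction_num_den (R : idomainType) (c : {fraction R}) :
  exists a b : R, b != 0 /\ c * FracField.tofrac b = FracField.tofrac a.
Proof.
elim/quotW: c => x; exists (frac x).1, (frac x).2; rewrite denom_ratioP; split=> //.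
unlock FracField.tofrac; rewrite -[LHS]FracField.pi_mul; apply/eqmodP.
rewrite /= FracField.equivfE /FracField.mulf /=.
by rewrite !numden_Ratio ?mulf_neq0 ?oner_neq0 ?denom_ratioP // !mulr1 mulrC.
Qed.

Section FunctionField.
Variables (K : finFieldType) (F : fieldExtType {fraction {poly K}}).
Variables (q r : nat) (lam : 'I_r.+1 -> K) (f g : {poly K}) (y : F).

Definition evy (U : {poly {poly K}}) : F := (map_poly (polyF F) U).[y].
HB.instance Definition _ := GRing.RMorphism.copy evy
  (horner_eval y \o map_poly (polyF F)).

Lemma evyC u : evy u%:P = polyF F u.
Proof. by rewrite /evy map_polyC hornerC. Qed.
Lemma evyX : evy 'X = y.
Proof. by rewrite /evy map_polyX hornerX. Qed.
Lemma evyZ u U : evy (u *: U) = polyF F u * evy U.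
Proof. by rewrite -mul_polyC rmorphM /= evyC. Qed.

Lemma evyB U V : evy (U - V) = evy U - evy V.
Proof. by rewrite /evy rmorphB hornerD hornerN. Qed.

Lemma evy_coef n (U : {poly {poly K}}) : (size U <= n)%N ->
  evy U = \sum_(i < n) polyF F U`_i * y ^+ i.
Proof.
move=> szU; rewrite /evy (@horner_coef_wide _ n) ?(leq_trans (size_poly _ _)) //.
by apply: eq_bigr => i _; rewrite coef_map.
Qed.

(** The polynomial g * L(Y) - f over K[x], a denominator-free multiple of the
defining equation of y. *)
Definition defpoly : {poly {poly K}} :=
  \sum_(i < r.+1) (g * (lam i)%:P) *: 'X^(q ^ i) - f%:P.

Hypotheses (q_gt1 : (1 < q)%N) (lamr : lam ord_max != 0) (g0 : g != 0).

Lemma defpoly_size_lead : size defpoly = (q ^ r).+1 /\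
  lead_coef defpoly = g * (lam ord_max)%:P.
Proof.
have c0 : g * (lam ord_max)%:P != 0 by rewrite mulf_neq0 ?polyC_eq0.
set c := g * _ in c0 *.
have sz1 : size (c *: 'X^(q ^ r)) = (q ^ r).+1 by rewrite size_scale // size_polyXn.
have sz2 : (size (\sum_(i < r) (g * (lam (widen_ord (leqnSn r) i))%:P) *: 'X^(q ^ i)
      - f%:P)%R < (q ^ r).+1)%N.
  rewrite ltnS (leq_trans (size_polyD _ _)) // geq_max; apply/andP; split.
    apply: (leq_trans (size_sum _ _ _)); apply/bigmax_leqP => i _.
    by apply: (leq_trans (@size_scale_leq _ _ _)); rewrite size_polyXn ltn_exp2l.
  by rewrite size_polyN (leq_trans (size_polyC_leq1 _)) // expn_gt0 ltnW.
have -> : defpoly = c *: 'X^(q ^ r) + (\sum_(i < r)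
   (g * (lam (widen_ord (leqnSn r) i))%:P) *: 'X^(q ^ i) - f%:P).
  by rewrite /defpoly big_ord_recr /= addrA [X in X - _ = _]addrC.
split; first by rewrite size_polyDl ?sz1.
by rewrite lead_coefDl ?sz1 // lead_coefZ lead_coefXn mulr1.
Qed.

(** Pseudo-division by the defining polynomial, whose leading coefficient is not a
unit of K[x]; the multiplier, a power of g up to a constant, does not vanish at
the points x0 where g does not. *)
Lemma defpoly_divp U : exists (s : nat) (W R : {poly {poly K}}),
  (size R <= q ^ r)%N /\ (g * (lam ord_max)%:P) ^+ s *: U = W * defpoly + R.
Proof.
have [sz <-] := defpoly_size_lead.
exists (scalp U defpoly), (U %/ defpoly), (U %% defpoly).
rewrite -Pdiv.WeakIdomain.divp_eq; split=> //.
rewrite -ltnS -sz ltn_modp -lead_coef_eq0.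
by rewrite (proj2 defpoly_size_lead) mulf_neq0 ?polyC_eq0.
Qed.

Hypothesis hy : (map_poly (constF F) (linearized q lam)).[y] = polyF F f / polyF
  F g.

Lemma evy_defpoly : evy defpoly = 0.
Proof.
rewrite /defpoly rmorphB /= evyC rmorph_sum /=; apply/eqP; rewrite subr_eq0.
have gF : polyF F g != 0 by rewrite polyF_eq0.
apply/eqP; rewrite -[RHS](divfK gF) -hy /linearized rmorph_sum /= horner_sum
  mulr_suml.
apply: eq_bigr => i _.
by rewrite evyZ rmorphXn /= evyX map_polyZ map_polyXn hornerZ hornerXn rmorphM /=
  [RHS]mulrC mulrA.
Qed.

Hypothesis hF : <<1; y>>%VS = fullv.

Lemma evy_surj z : exists (w : {poly K}) (U : {poly {poly K}}),
  w != 0 /\ z * polyF F w = evy U.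
Proof.
have /Fadjoin1_polyP[c ->] : z \in <<1; y>>%VS by rewrite hF memvf.
elim/poly_ind: c => [|c a [w [U [w0 wU]]]].
  by exists 1, 0; rewrite oner_neq0 rmorph0 horner0 mul0r rmorph0.
have [n [d [d0 ad]]] := fraction_num_den a.
exists (w * d), ((d%:P * U) * 'X + (w * n)%:P).
rewrite mulf_neq0 //; split=> //.
rewrite rmorphD rmorphM /= map_polyX map_polyC hornerMXaddC /=.
rewrite rmorphD !rmorphM /= !evyC evyX -wU.
have -> : polyF F n = a%:A * polyF F d.
  by rewrite /polyF -ad -scalerAl mul1r scalerA.
ring.
Qed.

(** The powers of y of exponent less than q ^ r span F over K(x); the elements of
K(x) are kept over a common denominator w so that only polynomials occur. *)
Lemma evy_repr z : exists (w : {poly K}) (U : {poly {poly K}}),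
  [/\ w != 0, (size U <= q ^ r)%N & z * polyF F w = evy U].
Proof.
have [w [U [w0 wU]]] := evy_surj z; have [s [W [R [szR RE]]]] := defpoly_divp U.
exists (w * (g * (lam ord_max)%:P) ^+ s), R; split=> //.
  by rewrite mulf_neq0 ?expf_neq0 // mulf_neq0 ?polyC_eq0.
have := congr1 evy RE; rewrite evyZ rmorphD rmorphM /= evy_defpoly mulr0 add0r =>
  <-.
by rewrite -wU [RHS]mulrC -mulrA -rmorphM.
Qed.
End FunctionField.

(** * Total ramification *)

Section Ramified.
Variables (K : finFieldType) (F : fieldExtType {fraction {poly K}}).
Variables (q r : nat) (lam : 'I_r.+1 -> K) (f g : {poly K}) (y : F).
Hypotheses (q_gt1 : (1 < q)%N) (lamr : lam ord_max != 0) (g0 : g != 0).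
Hypothesis hy : (map_poly (constF F) (linearized q lam)).[y] = polyF F f / polyF
  F g.
Hypothesis hF : <<1; y>>%VS = fullv.
Variables (t : F) (n : nat).
Hypotheses (t_param : base_param t) (n_gt0 : (0 < n)%N) (n_coprime : coprime n q).
Hypothesis pole_h : forall P : place F, 0 < P t ->
  P (polyF F f / polyF F g) = - (n%:Z * P t).

Let q_gt0 : (0 < q)%N. Proof. exact: ltnW. Qed.

Lemma linearized_horner :
  (map_poly (constF F) (linearized q lam)).[y] =
  \sum_i constF F (lam i) * y ^+ (q ^ i).
Proof.
rewrite rmorph_sum horner_sum; apply: eq_bigr => i _.
by rewrite /= map_polyZ map_polyXn hornerZ hornerXn.
Qed.

(** At a pole of y the monomials of L(y) have pairwise distinct values, and the
one of highest degree has the least. *)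
Lemma place_linearized_pole (P : place F) : P y < 0 ->
  P (\sum_i constF F (lam i) * y ^+ (q ^ i)) = (q ^ r)%N%:Z * P y.
Proof.
move=> Py; have y0 : y != 0 by apply: contraTneq Py => ->; rewrite place0 ltxx.
pose u i := constF F (lam i) * y ^+ (q ^ i).
have uP i : u i != 0 -> P (u i) = (q ^ i)%N%:Z * P y.
  rewrite mulf_eq0 negb_or => /andP[c0 yi0].
  by rewrite placeM // placeX placeC ?add0r // -(constF_eq0 F).
have umax : u ord_max != 0 by rewrite mulf_neq0 ?expf_neq0 ?constF_eq0.
have [|_ /(_ _ umax) le1 [i ui Pi]] := place_sum_distinct umax (P := P).
  move=> i j ui uj; rewrite !uP // => /mulIf; rewrite lt_eqF // => /(_ isT) [].
  by move/eqP; rewrite eqn_exp2l // => /eqP ij; apply: val_inj.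
move: le1; rewrite -/u Pi uP // uP //= ler_nM2r // lez_nat leq_exp2l // => ri.
by have /eqP-> : nat_of_ord i == r by rewrite eqn_leq ri -ltnS ltn_ord.
Qed.

Lemma place_linearized_ge0 (P : place F) : 0 <= P y ->
  0 <= P (\sum_i constF F (lam i) * y ^+ (q ^ i)).
Proof.
move=> Py; have : vge P 0 (\sum_i constF F (lam i) * y ^+ (q ^ i)).
  apply: vge_sum => i _; rewrite -[0]addr0; apply: vgeM; first exact: vge_const.
  by rewrite /vge placeX mulr_ge0 ?orbT.
by case/orP=> [/eqP->|//]; rewrite place0.
Qed.

(** Comparing values in L(y) = f / g gives q ^ r * P y = - n * P t; as n is prime
to q, q ^ r divides P t. *)
Lemma ramified_values (P : place F) : 0 < P t -> exists e : int,
  [/\ 0 < e, P t = (q ^ r)%N%:Z * e & P y = - (n%:Z * e)].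
Proof.
move=> Pt; have := pole_h Pt; rewrite -hy linearized_horner => hP.
have Py : P y < 0.
  rewrite ltNge; apply/negP => /place_linearized_ge0; rewrite hP oppr_ge0 leNgt.
  by rewrite mulr_gt0.
move: hP; rewrite place_linearized_pole // => hP.
have : ((q ^ r)%N %| P t)%Z.
  have cop : coprimez (q ^ r)%N n by rewrite /coprimez eqz_nat; apply: coprimeXl;
    rewrite coprime_sym.
  rewrite -(Gauss_dvdzr _ cop).
  have -> : n%:Z * P t = (q ^ r)%N%:Z * - P y by rewrite mulrN hP opprK.
  exact: dvdz_mulr.
case/dvdzP => e; rewrite mulrC => Pte.
have qr_gt0 : 0 < (q ^ r)%N%:Z by rewrite ltz_nat expn_gt0 q_gt0.
exists e; split=> //; first by rewrite Pte pmulr_rgt0 in Pt.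
by apply: (mulfI (lt0r_neq0 qr_gt0)); rewrite hP Pte; ring.
Qed.

(** The values of the terms R`_k * y ^+ k are congruent to - k n e modulo q ^ r e,
so those with k < q ^ r are pairwise distinct, because n is prime to q.  In
particular the powers of y are linearly independent over K(x). *)
Lemma ramified_sum (P : place F) (R : {poly {poly K}}) :
  0 < P t -> R != 0 -> (size R <= q ^ r)%N ->
  [/\ evy y R != 0,
      forall k, R`_k != 0 -> P (evy y R) <= P (polyF F R`_k * y ^+ k)
    & exists2 k, (k < q ^ r)%N /\ R`_k != 0 & P (evy y R) = P (polyF F R`_k * y
      ^+ k)].
Proof.
move=> Pt R0 szR; have [e [e0 Pte Pye]] := ramified_values Pt.
have y0 : y != 0 by apply: contraTneq e0 => y0; move: Pye n_gt0; rewrite y0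
  place0; nia.
rewrite (evy_coef _ szR); set u := fun k => polyF F R`_k * y ^+ k.
have u0 k : (u k != 0) = (R`_k != 0).
  by rewrite mulf_eq0 polyF_eq0 expf_eq0 (negbTE y0) andbF orbF.
have szk k : R`_k != 0 -> (k < q ^ r)%N.
  by move=> Rk; rewrite (leq_trans _ szR) // ltnNge; apply: contra Rk =>
    /leq_sizeP->.
have [k Rk] : exists k, R`_k != 0.
  by exists (size R).-1; rewrite -lead_coefE lead_coef_eq0.
pose uo (k : 'I_(q ^ r)) := u k.
have uok : uo (Ordinal (szk k Rk)) != 0 by rewrite u0.
have [|s0 sle [i ui Pi]] := place_sum_distinct uok (P := P).
  move=> i j; rewrite !u0 => Ri Rj; rewrite /uo /u !placeM ?expf_neq0 ?polyF_eq0 //.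
  have [ai aiP] := t_param Ri; have [aj ajP] := t_param Rj.
  rewrite aiP // ajP // !placeX Pte Pye => eq_ij.
  apply/val_inj/eqP; rewrite -eqz_nat -subr_eq0 -absz_eq0.
  have : ((q ^ r)%N %| (i%:Z - j%:Z) * n%:Z)%Z.
    apply/dvdzP; exists (ai - aj); apply: (mulIf (lt0r_neq0 e0)).
    apply/eqP; rewrite -subr_eq0; apply/eqP.
    by move: eq_ij => /eqP; rewrite -subr_eq0 => /eqP eq0; rewrite -[RHS]oppr0
      -eq0; ring.
  have cop : coprimez (q ^ r)%N n by rewrite /coprimez eqz_nat; apply: coprimeXl;
    rewrite coprime_sym.
  rewrite Gauss_dvdzl // dvdzE /= => /dvdnP[m]; case: m => [->//|m mE].
  have : (`|i%:Z - j%:Z| < q ^ r)%N by have := ltn_ord i; have := ltn_ord j;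
    clear; lia.
  by rewrite mE mulSn ltnNge leq_addr.
split=> //.
  by move=> l Rl; have := sle (Ordinal (szk l Rl)); apply; rewrite u0.
by exists i => //; split=> //; rewrite -u0.
Qed.

Let repr := evy_repr q_gt1 lamr g0 hy hF.

(** By the two previous lemmas every value of P is a multiple of e, and P takes
the value 1. *)
Lemma ramified_index (P : place F) : 0 < P t ->
  P t = (q ^ r)%N%:Z /\ P y = - n%:Z.
Proof.
move=> Pt; have [e [e0 Pte Pye]] := ramified_values Pt.
suff e1 : e = 1 by rewrite Pte Pye e1 !mulr1.
have y0 : y != 0 by apply: contraTneq e0 => y0; move: Pye n_gt0; rewrite y0
  place0; nia.
have [z Pz] := place_uniformizer P.
have z0 : z != 0 by apply/eqP => z0; move: Pz; rewrite z0 place0.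
have [w [R [w0 szR zw]]] := repr z.
have zwN : z * polyF F w != 0 by rewrite mulf_neq0 ?polyF_eq0.
have R0 : R != 0 by apply: contraNneq zwN => R0; rewrite zw R0 rmorph0.
have [_ _ [k [_ Rk] PR]] := ramified_sum Pt R0 szR.
have [a aP] := t_param w0; have [b bP] := t_param Rk.
move: PR; rewrite -zw !placeM ?expf_neq0 ?polyF_eq0 // Pz aP // bP // placeX Pte
  Pye => eq1.
have : (e %| 1)%Z.
  apply/dvdzP; exists (b * (q ^ r)%N%:Z - k%:Z * n%:Z - a * (q ^ r)%N%:Z).
  apply: (addIr (a * ((q ^ r)%N%:Z * e))); rewrite eq1; ring.
rewrite dvdz1; lia.
Qed.

(** A place above t is determined on all of F by its values on K[x] and at y: they
give the values of the terms R`_k * y ^+ k, of which it takes the minimum. *)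
Lemma ramified_unique (P1 P2 : place F) : 0 < P1 t -> 0 < P2 t -> P1 = P2.
Proof.
suff le12 (Q1 Q2 : place F) : 0 < Q1 t -> 0 < Q2 t ->
    forall z, z != 0 -> Q1 z <= Q2 z.
  by move=> ? ?; apply: eq_place => z z0; apply/eqP; rewrite eq_le !le12.
move=> Q1t Q2t z z0.
have [t1 y1] := ramified_index Q1t; have [t2 y2] := ramified_index Q2t.
have y0 : y != 0 by apply: contraTneq n_gt0 => y0; move: y1; rewrite y0 place0; lia.
have [w [R [w0 szR zw]]] := repr z.
have zwN : z * polyF F w != 0 by rewrite mulf_neq0 ?polyF_eq0.
have R0 : R != 0 by apply: contraNneq zwN => R0; rewrite zw R0 rmorph0.
have [_ le1 _] := ramified_sum Q1t R0 szR.
have [_ _ [k [_ Rk] eq2]] := ramified_sum Q2t R0 szR.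
have := le1 k Rk; move: eq2; rewrite -zw !placeM ?expf_neq0 ?polyF_eq0 // !placeX
  y1 y2.
have [a aP] := t_param w0; have [b bP] := t_param Rk.
by rewrite !aP // !bP // t1 t2; clear; lia.
Qed.
End Ramified.

(** * The place at an affine point of the curve *)

Section PlaceOfPoint.
Variables (K : finFieldType) (F : fieldExtType {fraction {poly K}}).
Variables (q r : nat) (lam : 'I_r.+1 -> K) (f g : {poly K}) (y : F).
Hypotheses (q_gt1 : (1 < q)%N) (q_pchar : [pchar K].-nat q).
Hypotheses (lam0 : lam ord0 != 0) (lamr : lam ord_max != 0) (g0 : g != 0).
Hypothesis hy : (map_poly (constF F) (linearized q lam)).[y] = polyF F f / polyF
  F g.
Hypothesis hF : <<1; y>>%VS = fullv.
Hypothesis indep : forall R : {poly {poly K}},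
  R != 0 -> (size R <= q ^ r)%N -> evy y R != 0.
Variables (k : fieldType) (iota : {rmorphism K -> k}) (x0 eta : k).
Local Notation "u ^k" := (map_poly iota u) (at level 2, format "u ^k").
Hypothesis gx0 : g^k.[x0] != 0.
Hypothesis eta_root :
  g^k.[x0] * (\sum_i iota (lam i) * eta ^+ (q ^ i)) = f^k.[x0].
Variable p : {poly K}.
Hypotheses (p0 : p != 0) (px0 : p^k.[x0] = 0).

Local Notation T := ('X - x0%:P).
Let Y := newton q (iota \o lam) f^k g^k x0 eta.

Let q_pchark : [pchar k].-nat q.
Proof. by rewrite (eq_pnat _ (fmorph_pchar iota)). Qed.
Let lam0k : (iota \o lam) ord0 != 0. Proof. by rewrite /= fmorph_eq0. Qed.

(** U(x, Y_N): the sequence of these polynomials plays the role of the image of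
U(x, y) in the power series ring k[[X - x0]] under y |-> lim Y_N, of which it
is an approximation modulo the (N + 1)-st power of X - x0. *)
Definition approx N (U : {poly {poly K}}) : {poly k} :=
  (map_poly (map_poly iota) U).[Y N].
HB.instance Definition _ N := GRing.RMorphism.copy (approx N)
  (horner_eval (Y N) \o map_poly (map_poly iota)).

Lemma approxC N u : approx N u%:P = u^k.
Proof. by rewrite /approx map_polyC hornerC. Qed.
Lemma approxX N : approx N 'X = Y N.
Proof. by rewrite /approx map_polyX hornerX. Qed.
Lemma approxZ N u U : approx N (u *: U) = u^k * approx N U.
Proof. by rewrite -mul_polyC rmorphM /= approxC. Qed.

Lemma approx_cauchy U N M : (N <= M)%N -> T ^+ N.+1 %| approx M U - approx N U.
Proof. exact: (horner_newton_cauchy q_gt1 q_pchark lam0k gx0 eta_root). Qed.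

Lemma approx_x0 U N :
  (approx N U).[x0] = (map_poly (horner_eval x0 \o map_poly iota) U).[eta].
Proof.
rewrite /approx -{1}(horner_newton_x0 q_gt1 q_pchark lam0k gx0 eta_root N) -/Y.
rewrite -horner_evalE -horner_map /= -map_poly_comp; congr (_.[_]).
Qed.

Lemma approx_defpoly N : T ^+ N.+1 %| approx N (defpoly q lam f g).
Proof.
have -> : approx N (defpoly q lam f g) = g^k * lin q (iota \o lam) (Y N) - f^k.
  rewrite /defpoly rmorphB rmorph_sum /= approxC; congr (_ - _).
  rewrite mulr_sumr; apply: eq_bigr => i _.
  rewrite approxZ rmorphXn /= approxX rmorphM /= map_polyC /=.
  by rewrite -mul_polyC mulrA.
exact: (newton_root q_gt1 q_pchark lam0k gx0 eta_root).
Qed.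

(** A relation U(x, y) = 0 is a multiple of the defining relation, up to a factor
that does not vanish at x0, because the powers of y of exponent less than q ^ r
are independent. *)
Lemma approx_ker U N : evy y U = 0 -> T ^+ N.+1 %| approx N U.
Proof.
move=> U0; have [s [W [R [szR RE]]]] := defpoly_divp f q_gt1 lamr g0 U.
have R0 : R = 0.
  apply/eqP; apply: contraTT isT => /indep/(_ szR)/eqP[].
  have := congr1 (evy y) RE.
  by rewrite evyZ U0 mulr0 rmorphD rmorphM /= (evy_defpoly g0 hy) mulr0 add0r.
have : T ^+ N.+1 %| approx N ((g * (lam ord_max)%:P) ^+ s *: U).
  by rewrite RE R0 addr0 rmorphM /= dvdp_mull // approx_defpoly.
rewrite approxZ Gauss_dvdpr // coprimep_expl // coprimep_sym coprimep_XsubC /root.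
rewrite rmorphXn rmorphM /= map_polyC horner_exp hornerM hornerC.
by rewrite expf_neq0 // mulf_neq0 // fmorph_eq0.
Qed.

Lemma approx_congr U V N : evy y U = evy y V -> T ^+ N.+1 %| approx N U - approx
  N V.
Proof.
move=> UV; have -> : approx N U - approx N V = approx N (U - V).
  by rewrite (rmorphB (approx N)).
by apply: approx_ker; rewrite evyB UV subrr.
Qed.

(** The order of vanishing at x0 of lim U(x, Y_N). *)
Definition evmult (U : {poly {poly K}}) (m : nat) : Prop :=
  exists N0, forall N, (N0 <= N)%N -> approx N U != 0 /\ mup x0 (approx N U) = m.

(** Since F is a field, U(x, y) V(x, y) = w(x) for some V and some nonzero w; the
order of U is then bounded by that of w, at every sufficiently fine
approximation. *)
Lemma evmult_exists U : evy y U != 0 -> exists m, evmult U m.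
Proof.
move=> U0; have [w [V [w0 wV]]] := evy_surj hF (evy y U)^-1.
have wk0 : w^k != 0 by rewrite map_poly_eq0.
pose N0 := mup x0 w^k.
(* In the limit U V equals w, so the order of U is at most N0. *)
have UVw N : T ^+ N.+1 %| approx N U * approx N V - w^k.
  rewrite -rmorphM -(approxC N w); apply: approx_congr.
  by rewrite evyC rmorphM /= -wV mulrA divff // mul1r.
have app N : (N0 <= N)%N -> approx N U != 0 /\ (mup x0 (approx N U) <= N)%N.
  move=> NN; have [UV0 mUV] := mup_congr wk0 NN (UVw N).
  have [U'0 V'0] : approx N U != 0 /\ approx N V != 0.
    by move: UV0; rewrite mulf_eq0 negb_or => /andP.
  split=> //; apply: leq_trans NN; rewrite /N0 -mUV mupM //.
  exact: leq_addr.
have [U'0 mU] := app N0 (leqnn _).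
exists (mup x0 (approx N0 U)), N0 => N NN.
exact: mup_congr U'0 mU (approx_cauchy U NN).
Qed.

Lemma evmult_fun U a b : evmult U a -> evmult U b -> a = b.
Proof.
move=> [N0 aP] [N1 bP].
have [_ <-] := aP _ (leq_maxl N0 N1); have [_ <-//] := bP _ (leq_maxr N0 N1).
Qed.

Lemma evmultM U V a b : evmult U a -> evmult V b -> evmult (U * V) (a + b).
Proof.
move=> [N0 aP] [N1 bP]; exists (maxn N0 N1) => N; rewrite geq_max => /andP[/aP[U0
  <-] /bP[V0 <-]].
by rewrite rmorphM mulf_neq0 //= mupM.
Qed.

Lemma evmultD U V a b c : evmult U a -> evmult V b -> evmult (U + V) c ->
  (minn a b <= c)%N.
Proof.
move=> [N0 aP] [N1 bP] [N2 cP]; pose N := maxn N0 (maxn N1 N2).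
have [U0 <-] := aP N (leq_maxl _ _).
have [|V0 <-] := bP N; first by rewrite /N maxnCA leq_maxl.
have [|W0 <-] := cP N; first by rewrite /N maxnA leq_maxr.
rewrite mup_geq // rmorphD dvdp_add // -mup_geq ?geq_minl //.
exact: geq_minr.
Qed.

Lemma evmult_congr U V a : evy y U = evy y V -> evmult U a -> evmult V a.
Proof.
move=> UV [N0 aP]; exists (maxn N0 a) => N; rewrite geq_max => /andP[/aP[U0 <-] aN].
by apply: mup_congr aN _ => //; apply: approx_congr.
Qed.

Lemma evmult_gt0 U m : evmult U m ->
  (0 < m)%N = ((map_poly (horner_eval x0 \o map_poly iota) U).[eta] == 0).
Proof.
move=> [N mP]; have [U0 <-] := mP N (leqnn _).
by rewrite -XsubC_dvd // dvdp_XsubCl /root approx_x0.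
Qed.

Lemma evmult_const c : c != 0 -> evmult c%:P%:P 0.
Proof.
move=> c0; exists 0%N => N _; rewrite approxC map_polyC polyC_eq0 fmorph_eq0 c0.
by split=> //; apply: mupNroot; rewrite /root hornerC fmorph_eq0.
Qed.

Definition fracval (z : F) (n : int) : Prop := exists (w : {poly K}) U a b,
  [/\ w != 0, z * polyF F w = evy y U, evmult U a, evmult w%:P b & n = a%:Z - b%:Z].

Lemma fracval_exists z : z != 0 -> exists n, fracval z n.
Proof.
move=> z0; have [w [U [w0 wU]]] := evy_surj hF z.
have [|a aP] := @evmult_exists U; first by rewrite -wU mulf_neq0 ?polyF_eq0.
have [|b bP] := @evmult_exists w%:P; first by rewrite evyC polyF_eq0.
by exists (a%:Z - b%:Z), w, U, a, b.
Qed.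

Lemma fracval_fun z n n' : fracval z n -> fracval z n' -> n = n'.
Proof.
move=> [w [U [a [b [w0 wU aP bP ->]]]]] [w' [U' [a' [b' [w'0 wU' aP' bP' ->]]]]].
have e1 : evy y (U * w'%:P) = evy y (U' * w%:P).
  by rewrite !rmorphM /= !evyC -wU -wU' mulrAC.
have := evmult_fun (evmult_congr e1 (evmultM aP bP')) (evmultM aP' bP); clear; lia.
Qed.

Lemma fracvalM z z' n n' : fracval z n -> fracval z' n' -> fracval (z * z') (n +
  n').
Proof.
move=> [w [U [a [b [w0 wU aP bP ->]]]]] [w' [U' [a' [b' [w'0 wU' aP' bP' ->]]]]].
exists (w * w'), (U * U'), (a + a')%N, (b + b')%N; split.
- by rewrite mulf_neq0.
- by rewrite !rmorphM /= -wU -wU' mulrACA.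
- exact: evmultM.
- by rewrite polyCM; apply: evmultM.
- by clear; lia.
Qed.

Lemma fracvalD z z' n n' m : fracval z n -> fracval z' n' -> fracval (z + z') m ->
  Order.min n n' <= m.
Proof.
move=> [w [U [a [b [w0 wU aP bP ->]]]]] [w' [U' [a' [b' [w'0 wU' aP' bP' ->]]]]].
move=> [v [V [c [d [v0 vV cP dP ->]]]]].
have e1 : evy y (V * (w * w')%:P) = evy y ((U * w'%:P + U' * w%:P) * v%:P).
  by rewrite !(rmorphM, rmorphD) /= !evyC -wU -wU' -vV; ring.
have VW := evmultM cP (evmultM bP bP'); rewrite -polyCM in VW.
have S1 := evmultM (evmultM aP bP') dP; have S2 := evmultM (evmultM aP' bP) dP.
rewrite mulrDl in e1.
have := evmultD S1 S2 (evmult_congr e1 VW); clear; lia.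
Qed.

(** Every point (x0, eta) of the curve g L(Y) = f with g.[x0] != 0 carries a place
of F, along which functions without denominators are regular and have the value
at the point as residue.  The order of vanishing at the point is positive on p,
so it can be normalized. *)
Lemma place_of_point : exists P : place F,
  0 < P (polyF F p) /\
  forall U, evy y U != 0 ->
    0 <= P (evy y U) /\
    (0 < P (evy y U) -> (map_poly (horner_eval x0 \o map_poly iota) U).[eta] = 0).
Proof.
pose v z := xget 0 [set n | fracval z n]%classic.
have vP z : z != 0 -> fracval z (v z).
  move=> z0; have [n nP] := fracval_exists z0.
  by rewrite /v; case: xgetP => [m _ //|/(_ n)]; case.
have evP U : evy y U != 0 -> exists2 m, evmult U m & v (evy y U) = m%:Z.
  move=> U0; have [m mP] := evmult_exists U0; exists m => //.
  apply: fracval_fun (vP _ U0) _; exists 1, U, m, 0%N; split=> //.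
  - exact: oner_neq0.
  - by rewrite rmorph1 mulr1.
  - exact: (evmult_const (oner_neq0 K)).
  - by rewrite subr0.
have pN : evy y p%:P != 0 by rewrite evyC polyF_eq0.
have vp : 0 < v (evy y p%:P).
  have [m mP ->] := evP _ pN; rewrite ltz_nat (evmult_gt0 mP).
  by rewrite map_polyC hornerC /= horner_evalE px0.
have [|||m m0 [P PE]] := @place_of_valuation K F v _ _ _ _ pN vp.
- by move=> u w u0 w0; apply: fracval_fun (vP _ _) (fracvalM (vP _ u0) (vP _
    w0)); rewrite mulf_neq0.
- by move=> u w u0 w0 uw0; apply: fracvalD (vP _ u0) (vP _ w0) (vP _ uw0).
- move=> c c0; have c1 : evy y c%:P%:P != 0 by rewrite evyC polyF_eq0 polyC_eq0.
  have [n nP] := evP _ c1; rewrite evyC => ->.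
  by rewrite (evmult_fun nP (evmult_const c0)).
exists P; split; first by rewrite -(evyC y) -(pmulr_rgt0 _ m0) -PE.
move=> U U0; have [n nP vU] := evP U U0; split.
  by rewrite -(pmulr_rge0 _ m0) -PE // vU.
by rewrite -(pmulr_rgt0 _ m0) -PE // vU ltz_nat (evmult_gt0 nP) => /eqP.
Qed.
End PlaceOfPoint.

(** * Integrality away from the zeros of g *)

Section Integrality.
Variables (K : finFieldType) (F : fieldExtType {fraction {poly K}}).
Variables (q r : nat) (lam : 'I_r.+1 -> K) (f g : {poly K}) (y : F).
Hypotheses (q_gt1 : (1 < q)%N) (q_pchar : [pchar K].-nat q).
Hypotheses (lam0 : lam ord0 != 0) (lamr : lam ord_max != 0) (g0 : g != 0).
Hypothesis hroots : #|[set c : K | root (linearized q lam) c]%SET| = (q ^ r)%N.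
Hypothesis hy : (map_poly (constF F) (linearized q lam)).[y] = polyF F f / polyF
  F g.
Hypothesis hF : <<1; y>>%VS = fullv.
Hypothesis indep : forall R : {poly {poly K}},
  R != 0 -> (size R <= q ^ r)%N -> evy y R != 0.

(** Choose a root x0 of p in an algebraic closure.  The roots of L in K translate
one solution eta of L(eta) = f(x0) / g(x0) into q ^ r of them.  If p divides w
then w z vanishes at the place of each of the points (x0, eta + c), so that the
polynomial U(x0, Y), of degree less than q ^ r, has q ^ r distinct roots.  Hence
x0 is a root of all the coefficients of U. *)
Lemma unramified_integral (p w : {poly K}) (z : F) (U : {poly {poly K}}) :
  irreducible_poly p -> coprimep p g -> z != 0 -> w != 0 ->
  (forall P : place F, 0 < P (polyF F p) -> 0 <= P z) ->
  p %| w -> (size U <= q ^ r)%N -> z * polyF F w = evy y U ->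
  forall k, p %| U`_k.
Proof.
move=> pirr pg z0 w0 Pz pw szU zw.
have [k [iota _]] := countable_algebraic_closure K.
pose phi x0 : {rmorphism {poly K} -> k} := horner_eval x0 \o map_poly iota.
have [x0 px0] : exists x0, root (map_poly iota p) x0.
  by apply/closed_rootP; rewrite size_map_poly; case: pirr => s1 _; rewrite gtn_eqF.
have gx0 : (map_poly iota g).[x0] != 0.
  by apply: coprimep_root px0; rewrite coprimep_map.
have solve x : (map_poly (phi x0) (defpoly q lam f g)).[x] =
   (map_poly iota g).[x0] * (\sum_i iota (lam i) * x ^+ (q ^ i)) - (map_poly iota
     f).[x0].
  rewrite /defpoly rmorphB rmorph_sum /= map_polyC hornerD hornerN hornerC; congr
    (_ - _).
  rewrite horner_sum mulr_sumr; apply: eq_bigr => i _.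
  rewrite map_polyZ map_polyXn hornerZ hornerXn /= horner_evalE rmorphM hornerM /=.
  by rewrite map_polyC hornerC mulrA.
have [sz lc] := defpoly_size_lead f q_gt1 lamr g0.
have [eta] : exists eta, root (map_poly (phi x0) (defpoly q lam f g)) eta.
  apply/closed_rootP; rewrite size_map_poly_id0 ?sz.
    by rewrite eqSS expn_eq0 negb_and -lt0n ltnW.
  rewrite lc /= horner_evalE rmorphM hornerM /= map_polyC hornerC.
  by rewrite mulf_neq0 ?fmorph_eq0.
rewrite /root solve subr_eq0 => /eqP etaE.
have translate (c : K) : root (linearized q lam) c ->
    (map_poly iota g).[x0] * (\sum_i iota (lam i) * (eta + iota c) ^+ (q ^ i)) =
    (map_poly iota f).[x0].
  move=> /eqP Lc; rewrite -etaE; congr (_ * _).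
  transitivity (\sum_i iota (lam i) * eta ^+ (q ^ i) + iota (linearized q lam).[c]).
    rewrite /linearized horner_sum rmorph_sum -big_split; apply: eq_bigr => i _ /=.
    rewrite hornerZ hornerXn rmorphM rmorphXn -mulrDr exprDn_pchar //.
    by rewrite (eq_pnat _ (fmorph_pchar iota)) pnatX q_pchar.
  by rewrite Lc rmorph0 addr0.
have zwN : evy y U != 0 by rewrite -zw mulf_neq0 ?polyF_eq0.
have Uroot c : root (linearized q lam) c -> (map_poly (phi x0) U).[eta + iota c]
  = 0.
  move=> /translate etacE.
  have [P [Pp PU]] := place_of_point q_gt1 q_pchar lam0 lamr g0 hy hF indep gx0
    etacE (irredp_neq0 pirr) (eqP px0).
  have [_] := PU U zwN; apply; rewrite -zw placeM ?polyF_eq0 //.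
  apply: ltr_wpDl; first exact: Pz.
  have wE := divpK pw; have [wp0 _] := divp_irreducible pirr w0 pw.
  rewrite -wE rmorphM placeM ?polyF_eq0 // ?(irredp_neq0 pirr) //.
  apply: ltr_wpDl => //; apply: place_poly_ge0; exact: place_xF_ge0 Pp.
have U0 : map_poly (phi x0) U = 0.
  (* q ^ r distinct roots, more than the degree of U in Y allows. *)
  pose rs := [seq eta + iota c | c <- enum [set c : K | root (linearized q lam)
    c]%SET].
  apply: (@roots_geq_poly_eq0 _ _ rs).
  - apply/allP => x /mapP[c]; rewrite mem_enum inE => cr ->.
    exact/eqP/Uroot.
  - rewrite map_inj_uniq ?enum_uniq // => c1 c2 /addrI; exact: fmorph_inj.
  - by rewrite size_map -cardE hroots (leq_trans _ szU) // size_poly.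
move=> i; have Ui : root (map_poly iota U`_i) x0.
  by have := congr1 (fun V : {poly k} => V`_i) U0; rewrite coef_map coef0 /=
    horner_evalE => /eqP.
apply: contraLR Ui; rewrite -irreducible_poly_coprime // => cop.
by apply: coprimep_root px0; rewrite coprimep_map.
Qed.

(** A prime of the denominator that does not divide g divides all the coefficients
of the numerator, and can be cancelled. *)
Lemma integral_denominator (z : F) : z != 0 ->
  (forall p, irreducible_poly p -> coprimep p g ->
    forall P : place F, 0 < P (polyF F p) -> 0 <= P z) ->
  exists (w : {poly K}) (U : {poly {poly K}}),
  [/\ w != 0, (size U <= q ^ r)%N, z * polyF F w = evy y U
    & forall p, irreducible_poly p -> p %| w -> p %| g].
Proof.
move=> z0 Pz; have [w [U [w0 szU zw]]] := evy_repr q_gt1 lamr g0 hy hF z.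
have [n] := ubnP (size w); elim: n w U w0 szU zw => // n IHn w U w0 szU zw szw.
have [[p [pirr pw npg]]|nex] := pselect (exists p : {poly K}, [/\
  irreducible_poly p, p %| w & ~~ (p %| g)]);
  last first.
  exists w, U; split=> // p pirr pw; apply: contrapT => /negP npg.
  by apply: nex; exists p.
have pg : coprimep p g by rewrite irreducible_poly_coprime.
have pU := unramified_integral pirr pg z0 w0 (Pz p pirr pg) pw szU zw.
have wE := divpK pw; have [wp0 szd] := divp_irreducible pirr w0 pw.
have p0 := irredp_neq0 pirr.
pose U' := \poly_(i < q ^ r) (U`_i %/ p).
have UE : U = p *: U'.
  apply/polyP => i; rewrite coefZ coef_poly; case: ltnP => [_|qi].
    by rewrite mulrC divpK.
  by rewrite mulr0 nth_default // (leq_trans szU).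
apply: (IHn (w %/ p) U') => //; first exact: size_poly.
  have pF : polyF F p != 0 by rewrite polyF_eq0.
  by apply: (mulfI pF); rewrite -evyZ -UE -zw -{2}wE rmorphM /=; ring.
exact: leq_trans szd szw.
Qed.
End Integrality.

(** * The Riemann-Roch space *)

Section KspanTheory.
Variables (K : finFieldType) (F : fieldExtType {fraction {poly K}}) (S : set F).

Lemma Kspan0 : Kspan S 0.
Proof. by exists 0%N, (fun=> 0), (fun=> 0); split=> [[]//|]; rewrite big_ord0. Qed.

Lemma Kspan_scale c w : S w -> Kspan S (constF F c * w).
Proof. by move=> Sw; exists 1%N, (fun=> c), (fun=> w); split=> //; rewrite
  big_ord1. Qed.

Lemma KspanD u v : Kspan S u -> Kspan S v -> Kspan S (u + v).
Proof.
move=> [l [c [w [Sw ->]]]] [l' [c' [w' [Sw' ->]]]].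
pose c2 i := match split i with inl j => c j | inr j => c' j end.
pose w2 i := match split i with inl j => w j | inr j => w' j end.
exists (l + l')%N, c2, w2; split.
  by move=> i; rewrite /w2; case: (split i).
rewrite big_split_ord; congr (_ + _); apply: eq_bigr => i _; rewrite /c2 /w2.
  by case: split_ordP => j /eqP; rewrite ?eq_lrshift // eq_lshift => /eqP->.
by case: split_ordP => j /eqP; rewrite ?eq_rlshift // eq_rshift => /eqP->.
Qed.

Lemma Kspan_sum (I : finType) (u : I -> F) :
  (forall i, Kspan S (u i)) -> Kspan S (\sum_i u i).
Proof. by move=> Su; elim/big_ind: _ => [||//]; [apply: Kspan0|apply: KspanD]. Qed.

Lemma Kspan_sub_RRspace (G : divisor F) : (S `<=` RRspace G)%classic ->
  (Kspan S `<=` RRspace G)%classic.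
Proof.
move=> SG z [l [c [w [Sw ->]]]] z0 P.
suff /orP[/eqP z00|//] : vge P (- coeff P G) (\sum_(i < l) constF F (c i) * w i).
  by rewrite z00 eqxx in z0.
apply: vge_sum => i _; rewrite -[- _]add0r; apply: vgeM; first exact: vge_const.
by rewrite /vge; have [//|wi] := eqVneq (w i) 0; rewrite SG.
Qed.
End KspanTheory.

Section RiemannRoch.
Variables (K : finFieldType) (F : fieldExtType {fraction {poly K}}).
Variables (q r : nat) (lam : 'I_r.+1 -> K) (f g : {poly K}) (y : F).
Hypotheses (q_gt1 : (1 < q)%N) (q_pchar : [pchar K].-nat q).
Hypotheses (lam0 : lam ord0 != 0) (lamr : lam ord_max != 0).
Hypothesis hroots : #|[set c : K | root (linearized q lam) c]%SET| = (q ^ r)%N.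
Hypothesis hfg : coprimep f g.
Variables (s : nat) (cg : K) (pg : 'I_s -> {poly K}) (ng : 'I_s -> nat).
Hypotheses (hcg : cg != 0) (hpg : forall i, irreducible_poly (pg i)).
Hypothesis hpg_distinct : forall i1 i2, i1 != i2 -> ~~ (pg i1 %= pg i2).
Hypothesis hng : forall i, (0 < ng i)%N.
Hypothesis hg : g = cg *: \prod_(i < s) pg i ^+ ng i.
Hypothesis hd : (degp g < degp f)%N.
Hypothesis hng_coprime : forall i, coprime (ng i) q.
Hypothesis hd_coprime : coprime (degp f - degp g) q.
Hypothesis hF : <<1; y>>%VS = fullv.
Hypothesis hy : (map_poly (constF F) (linearized q lam)).[y] = polyF F f / polyF
  F g.
Variables (Q : 'I_s -> place F) (Qoo : place F).
Hypotheses (hQ : forall i, is_zero (polyF F (pg i)) (Q i)) (hQoo : is_pole (xF F)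
  Qoo).

Lemma g_neq0 : g != 0.
Proof.
rewrite hg scaler_eq0 (negbTE hcg) /=; apply/prodf_neq0 => i _.
by rewrite expf_neq0 // irredp_neq0.
Qed.
Lemma f_neq0 : f != 0.
Proof. by apply: contraTneq hd => ->; rewrite /degp size_poly0. Qed.

Lemma pg_coprime i j : i != j -> coprimep (pg i) (pg j).
Proof.
move=> /hpg_distinct nij; rewrite irreducible_poly_coprime //.
apply: contra nij => pij; case: (hpg j) => _; apply => //.
by case: (hpg i) => s1 _; rewrite gtn_eqF.
Qed.

Lemma pg_dvd_g i : pg i %| g.
Proof.
rewrite hg dvdpZr // (bigD1 i) //= dvdp_mulr // -{1}[pg i]expr1.
exact: dvdp_exp2l.
Qed.

Lemma pole_pg i (P : place F) : 0 < P (polyF F (pg i)) ->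
  P (polyF F f / polyF F g) = - ((ng i)%:Z * P (polyF F (pg i))).
Proof.
move=> Pi; rewrite placeM ?invr_eq0 ?polyF_eq0 ?f_neq0 ?g_neq0 // placeV.
rewrite (place_coprime Pi); last first.
  by rewrite coprimep_sym; apply: coprimep_dvdl hfg; apply: pg_dvd_g.
rewrite add0r hg -mul_polyC rmorphM placeM ?polyF_eq0 ?polyC_eq0 //; last first.
  by apply/prodf_neq0 => j _; rewrite expf_neq0 // irredp_neq0.
rewrite placeC // add0r rmorph_prod place_prod => [|j _]; last first.
  by rewrite polyF_eq0 expf_neq0 // irredp_neq0.
rewrite (bigD1 i) //= big1 ?addr0 => [|j ji]; first by rewrite rmorphXn placeX.
by rewrite rmorphXn placeX (place_coprime Pi) ?mulr0 // pg_coprime // eq_sym.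
Qed.

Lemma pole_infty (P : place F) : 0 < P (xF F)^-1 ->
  P (polyF F f / polyF F g) = - ((degp f - degp g)%N%:Z * P (xF F)^-1).
Proof.
rewrite placeV oppr_gt0 => Px.
rewrite placeM ?invr_eq0 ?polyF_eq0 ?f_neq0 ?g_neq0 // placeV (place_poly_pole f
  Px) (place_poly_pole g Px).
by rewrite -subzn ?(ltnW hd) //; ring.
Qed.

Let d_gt0 : (0 < degp f - degp g)%N. Proof. by rewrite subn_gt0. Qed.

Lemma infty_unique (P : place F) : P (xF F) < 0 -> P = Qoo.
Proof.
move=> Px; apply: (ramified_unique q_gt1 lamr g_neq0 hy hF (base_param_infty F)
  d_gt0 hd_coprime pole_infty);
  by rewrite placeV oppr_gt0 //; case: hQoo.
Qed.

Lemma Q_unique i (P : place F) : 0 < P (polyF F (pg i)) -> P = Q i.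
Proof.
move=> Px; apply: (ramified_unique q_gt1 lamr g_neq0 hy hF
  (base_param_irreducible F (hpg i)) (hng i) (hng_coprime i) (@pole_pg i)) => //.
by case: (hQ i).
Qed.

Let Qoo_inv : 0 < Qoo (xF F)^-1.
Proof. by rewrite placeV oppr_gt0; case: hQoo. Qed.
Let Qi_pos i : 0 < Q i (polyF F (pg i)). Proof. by case: (hQ i). Qed.

Lemma infty_index : Qoo (xF F) = - (q ^ r)%N%:Z /\ Qoo y = - ((degp f)%:Z - (degp
  g)%:Z).
Proof.
have [] := ramified_index q_gt1 lamr g_neq0 hy hF (base_param_infty F) d_gt0
  hd_coprime pole_infty Qoo_inv.
by rewrite placeV -subzn ?(ltnW hd) // => <- ->; rewrite opprK.
Qed.

Lemma Q_index i : Q i (polyF F (pg i)) = (q ^ r)%N%:Z /\ Q i y = - (ng i)%:Z.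
Proof.
exact: (ramified_index q_gt1 lamr g_neq0 hy hF (base_param_irreducible F (hpg i))
  (hng i) (hng_coprime i) (@pole_pg i)).
Qed.

Lemma ramified_infty_sum (R : {poly {poly K}}) : R != 0 -> (size R <= q ^ r)%N ->
  evy y R != 0 /\ forall k, R`_k != 0 -> Qoo (evy y R) <= Qoo (polyF F R`_k * y
    ^+ k).
Proof.
move=> R0 szR.
by have [] := ramified_sum q_gt1 lamr g_neq0 hy (base_param_infty F) d_gt0
  hd_coprime pole_infty Qoo_inv R0 szR.
Qed.

Lemma ramified_Q_sum i (R : {poly {poly K}}) : R != 0 -> (size R <= q ^ r)%N ->
  forall k, R`_k != 0 -> Q i (evy y R) <= Q i (polyF F R`_k * y ^+ k).
Proof.
move=> R0 szR.
by have [] := ramified_sum q_gt1 lamr g_neq0 hy (base_param_irreducible F (hpg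
  i)) (hng i) (hng_coprime i) (@pole_pg i) (Qi_pos i) R0 szR.
Qed.

Lemma y_neq0 : y != 0.
Proof.
by have [_] := infty_index; apply: contra_eq_neq => ->; rewrite place0; move: hd;
  lia.
Qed.

Lemma Q_x_ge0 i : 0 <= Q i (xF F).
Proof. exact: place_xF_ge0 (Qi_pos i). Qed.

Lemma Q_neq_Qoo i : Q i <> Qoo.
Proof. by move=> QQ; have := Q_x_ge0 i; rewrite QQ leNgt; case: hQoo => _ ->. Qed.

Lemma Q_pg i j : i != j -> Q i (polyF F (pg j)) = 0.
Proof. by move=> ij; apply: place_coprime (Qi_pos i) (pg_coprime ij). Qed.

Lemma Q_inj i j : Q i = Q j -> i = j.
Proof.
move=> QQ; apply/eqP; apply: contraTT isT => ij.
by have := Qi_pos i; rewrite QQ Q_pg ?ltxx // eq_sym.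
Qed.

(** Away from the zeros of the pg i and the poles of x, L(y) is regular, which
prevents y from having a pole. *)
Lemma unramified_place (P : place F) : P <> Qoo -> (forall i, P <> Q i) ->
  [/\ 0 <= P (xF F), forall i, P (polyF F (pg i)) = 0 & 0 <= P y].
Proof.
move=> Poo PQ.
have Px : 0 <= P (xF F) by rewrite leNgt; apply/negP => /infty_unique.
have Pp i : P (polyF F (pg i)) = 0.
  apply/eqP; rewrite eq_le place_poly_ge0 // andbT leNgt.
  by apply/negP => /Q_unique; apply: PQ.
split=> //; rewrite leNgt; apply/negP => Py.
have := place_linearized_pole q_gt1 lamr Py; rewrite -linearized_horner hy.
rewrite placeM ?invr_eq0 ?polyF_eq0 ?f_neq0 ?g_neq0 // placeV.
have -> : P (polyF F g) = 0.
  rewrite hg -mul_polyC rmorphM placeM ?polyF_eq0 ?polyC_eq0 //; last first.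
    by apply/prodf_neq0 => j _; rewrite expf_neq0 // irredp_neq0.
  rewrite placeC // add0r rmorph_prod place_prod => [|j _]; last first.
    by rewrite polyF_eq0 expf_neq0 // irredp_neq0.
  by rewrite big1 // => j _; rewrite rmorphXn placeX Pp mulr0.
have := place_poly_ge0 f Px; have : 0 < (q ^ r)%N%:Z by rewrite ltz_nat expn_gt0
  ltnW.
nia.
Qed.

Variables (a : 'I_s -> int) (boo : int).
Let G : divisor F := \sum_(i < s) << a i *g Q i >> + << boo *g Qoo >>.

Lemma coeffG P : coeff P G = \sum_(i < s) a i * (Q i == P)%:R + boo * (Qoo == P)%:R.
Proof.
rewrite /G coeffD coeffU; congr (_ + _); rewrite raddf_sum /=.
by apply: eq_bigr => i _; rewrite coeffU.
Qed.

Lemma coeff_Q i : coeff (Q i) G = a i.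
Proof.
rewrite coeffG (bigD1 i) //= eqxx mulr1 big1 => [|j ji].
  have /eqP/negPf-> : Qoo <> Q i by move/esym/Q_neq_Qoo.
  by rewrite mulr0 !addr0.
have /eqP/negPf-> : Q j <> Q i by move/Q_inj => jiE; rewrite jiE eqxx in ji.
by rewrite /= mulr0.
Qed.

Lemma coeff_Qoo : coeff Qoo G = boo.
Proof.
rewrite coeffG eqxx mulr1 big1 ?add0r // => j _.
by have /eqP/negPf-> := @Q_neq_Qoo j; rewrite /= mulr0.
Qed.

Lemma coeff_other P : P <> Qoo -> (forall i, P <> Q i) -> coeff P G = 0.
Proof.
move=> Poo PQ; rewrite coeffG big1 => [|j _].
  have /eqP/negPf-> : Qoo <> P by move/esym/Poo.
  by rewrite mulr0 addr0.
have /eqP/negPf-> : Q j <> P by move/esym/PQ.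
by rewrite mulr0.
Qed.

(** The values of the generators, to be compared with the coefficients of G. *)
Lemma place_monomial (P : place F) (k : nat) (j : int) (e : 'I_s -> int) :
  P (y ^+ k * xF F ^ j * \prod_(i < s) polyF F (pg i) ^ e i) =
  k%:Z * P y + j * P (xF F) + \sum_(i < s) e i * P (polyF F (pg i)).
Proof.
have pN i : polyF F (pg i) != 0 by rewrite polyF_eq0 irredp_neq0.
rewrite !placeM ?mulf_neq0 ?expf_neq0 ?expfz_neq0 ?xF_neq0 ?y_neq0 //; last first.
  by apply/prodf_neq0 => i _; rewrite expfz_neq0.
rewrite placeX placeXz place_prod => [|i _]; last (apply: expfz_neq0; exact: pN).
by congr (_ + _); apply: eq_bigr => i _; rewrite placeXz.
Qed.

Let S : set F :=
    [set z : F | exists (k : nat) (eoo : int) (ee : 'I_s -> int),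
      [/\ (k <= q ^ r - 1)%N,
          0 <= eoo,
          forall i, - a i <= - (k%:Z * (ng i)%:Z) + (q ^ r)%N%:Z * ee i,
          k%:Z * ((degp f)%:Z - (degp g)%:Z)
            + (q ^ r)%N%:Z * (eoo + \sum_(i < s) ee i * (degp (pg i))%:Z) <= boo
        & z = y ^+ k * xF F ^ eoo * \prod_(i < s) polyF F (pg i) ^ ee i]]%classic.

Lemma generators_sub_RRspace : (S `<=` RRspace G)%classic.
Proof.
move=> z [k [j [e [_ j0 ea eb zE]]]] z0 P; rewrite zE place_monomial.
have [->|Poo] := pselect (P = Qoo).
  have [xoo yoo] := infty_index; rewrite coeff_Qoo yoo xoo.
  rewrite (eq_bigr (fun i => (e i * (degp (pg i))%:Z) * - (q ^ r)%N%:Z)) => [|i _].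
    rewrite -mulr_suml lerNl; apply: le_trans eb; rewrite le_eqVlt; apply/orP; left.
    by apply/eqP; ring.
  by rewrite place_poly_pole ?xoo ?mulrA //; case: hQoo; rewrite xoo.
have [[i ->]|PQ] := pselect (exists i, P = Q i).
  rewrite coeff_Q (bigD1 i) //= big1 => [|l li]; last by rewrite Q_pg ?mulr0 //
    eq_sym.
  have [-> ->] := Q_index i; have := ea i; have := mulr_ge0 j0 (Q_x_ge0 i); lia.
have {}PQ i : P <> Q i by move=> Pi; apply: PQ; exists i.
have [Px Pp Py] := unramified_place Poo PQ.
rewrite coeff_other // oppr0 big1 => [|i _]; last by rewrite Pp mulr0.
by rewrite addr0 addr_ge0 // mulr_ge0.
Qed.

Lemma RRspace_sub_Kspan : (RRspace G `<=` Kspan S)%classic.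
Proof.
move=> z zG; have [->|z0] := eqVneq z 0; first exact: Kspan0.
have {}zG := zG z0; have g0 := g_neq0.
have Pz p : irreducible_poly p -> coprimep p g ->
    forall P : place F, 0 < P (polyF F p) -> 0 <= P z.
  move=> pirr pg0 P Pp; have := zG P; rewrite coeff_other ?oppr0 //.
    by move=> PE; have := place_xF_ge0 Pp; rewrite PE leNgt; case: hQoo => _ ->.
  move=> i Pi; have /eqP := place_coprime Pp (coprimep_dvdl (pg_dvd_g i) pg0).
  by rewrite Pi gt_eqF.
have indep R (R0 : R != 0) szR := proj1 (ramified_infty_sum R0 szR).
have [w [U [w0 szU zw wg]]] := integral_denominator q_gt1 q_pchar lam0 lamr g0
  hroots hy hF indep z0 Pz.
have U0 : U != 0.
  have : z * polyF F w != 0 by rewrite mulf_neq0 ?polyF_eq0.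
  by apply: contraNneq => U0; rewrite zw U0 rmorph0.
have [v [l [v0 wE vcop]]] := factor_out hpg w0.
(* What is left of the denominator has no prime factor: it would divide g, hence
  be one of the pg i. *)
have [c c0 vE] : exists2 c : K, c != 0 & v = c%:P.
  have sv : (0 < size v)%N by rewrite size_poly_gt0.
  have : ~ (1 < size v)%N.
    move=> /irreducible_factor[p pirr pv].
    have : p %| g by apply: wg => //; rewrite wE dvdp_mulr.
    apply/negP; rewrite -irreducible_poly_coprime // hg coprimepZr //.
    elim/big_ind: _ => [|u u' cu cu'|i _]; [exact: coprimep1|by rewrite
      coprimepMr cu|].
    apply: coprimep_expr.
    rewrite irreducible_poly_coprime //; apply/negP => ppi.
    have := vcop i; rewrite irreducible_poly_coprime // => /negP; apply.
    have ppiE : p %= pg i by case: (hpg i) => _; apply => //; case: pirr => s1 _;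
      rewrite gtn_eqF.
    by rewrite -(eqp_dvdl v ppiE).
  move/negP; rewrite -leqNgt => /size1_polyC vE.
  by exists v`_0 => //; apply: contraNneq v0 => v00; rewrite vE v00.
have wN : polyF F w != 0 by rewrite polyF_eq0.
have pN i : polyF F (pg i) != 0 by rewrite polyF_eq0 irredp_neq0.
have -> : z = \sum_(k < q ^ r) polyF F U`_k / polyF F w * y ^+ k.
  apply: (mulIf wN); rewrite zw (evy_coef _ szU) mulr_suml; apply: eq_bigr => k _.
  by rewrite mulrAC divfK.
apply: Kspan_sum => k.
have [Uk|Uk] := eqVneq U`_k 0; first by rewrite Uk rmorph0 !mul0r; apply: Kspan0.
have [u [m [u0 uE ucop]]] := factor_out hpg Uk.
pose e i : int := (m i)%:Z - (l i)%:Z.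
have UwE : polyF F U`_k / polyF F w = constF F c^-1 * polyF F u * \prod_i polyF F
  (pg i) ^ e i.
  apply: (mulIf wN); rewrite divfK // wE uE vE !rmorphM /= !rmorph_prod.
  rewrite -[polyF F c%:P]/(constF F c) fmorphV.
  have -> : \prod_i polyF F (pg i ^+ m i) =
     \prod_i polyF F (pg i) ^ e i * \prod_i polyF F (pg i ^+ l i).
    rewrite -big_split; apply: eq_bigr => i _ /=.
    by rewrite !rmorphXn !exprnP -expfzDr // /e subrK.
  have cN : constF F c != 0 by rewrite constF_eq0.
  by field.
have uN : polyF F u != 0 by rewrite polyF_eq0.
have prodN : \prod_i polyF F (pg i) ^ e i != 0.
  by apply/prodf_neq0 => i _; apply: expfz_neq0; apply: pN.
have termP (P : place F) : P (polyF F U`_k / polyF F w * y ^+ k) =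
    P (polyF F u) + (k%:Z * P y + \sum_i e i * P (polyF F (pg i))).
  have -> : polyF F U`_k / polyF F w * y ^+ k = constF F c^-1 * (polyF F u *
     (y ^+ k * xF F ^ 0 * \prod_i polyF F (pg i) ^ e i)).
    by rewrite UwE expr0z; ring.
  have monN : y ^+ k * xF F ^ 0 * \prod_i polyF F (pg i) ^ e i != 0.
    by rewrite expr0z mulr1 mulf_neq0 ?expf_neq0 ?y_neq0.
  have cN : c^-1 != 0 by rewrite invr_eq0.
  rewrite placeM; [|by rewrite constF_eq0|exact: mulf_neq0].
  rewrite (placeC P cN) add0r.
  by rewrite placeM // place_monomial mul0r addr0.
have term_ge (P : place F) : P (evy y U) <= P (polyF F U`_k * y ^+ k) ->
    P z <= P (polyF F U`_k / polyF F w * y ^+ k).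
  have ykN : y ^+ k != 0 by rewrite expf_neq0 ?y_neq0.
  rewrite -zw (mulrAC _ _ (y ^+ k)) !placeM ?mulf_neq0 ?invr_eq0 ?polyF_eq0 //
    placeV.
  by rewrite lerBrDr.
(* Expanding u in powers of x gives the generators with exponent k of y; degp u
  bounds the exponents of x. *)
rewrite UwE polyF_coef mulr_sumr !mulr_suml; apply: Kspan_sum => j.
have -> : constF F c^-1 * (constF F u`_j * xF F ^+ j) * \prod_i polyF F (pg i) ^
  e i * y ^+ k =
    constF F (c^-1 * u`_j) * (y ^+ k * xF F ^ (j%:Z) * \prod_i polyF F (pg i) ^ e
      i).
  by rewrite rmorphM /= -exprnP; ring.
apply: Kspan_scale; exists k, j%:Z, e; split=> //.
- by rewrite -ltnS subn1 prednK ?ltn_ord // expn_gt0 ltnW.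
- move=> i; have := zG (Q i); rewrite coeff_Q => zGi.
  apply: (le_trans zGi); apply: le_trans (term_ge _ (ramified_Q_sum i U0 szU Uk)) _.
  rewrite termP (place_coprime (Qi_pos i) (ucop i)) add0r (proj2 (Q_index i)).
  rewrite (bigD1 i) //= big1 => [|i' ii']; last by rewrite Q_pg ?mulr0 // eq_sym.
  by rewrite (proj1 (Q_index i)) le_eqVlt; apply/orP; left; apply/eqP; ring.
have := zG Qoo; rewrite coeff_Qoo => /le_trans/(_ (term_ge _ (proj2
  (ramified_infty_sum U0 szU) k Uk))).
have [xoo yoo] := infty_index; have Px : Qoo (xF F) < 0 by case: hQoo.
rewrite termP (place_poly_pole u Px) xoo yoo.
rewrite (eq_bigr (fun i => (e i * (degp (pg i))%:Z) * - (q ^ r)%N%:Z)) => [|i _];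
  last first.
  by rewrite (place_poly_pole (pg i) Px) xoo mulrA.
rewrite -mulr_suml lerNl; apply: le_trans.
have ju : j%:Z <= (degp u)%:Z.
  by rewrite lez_nat /degp -ltnS prednK ?ltn_ord // size_poly_gt0.
rewrite -subr_ge0; set X := \sum_i _.
have -> : - ((degp u)%:Z * - (q ^ r)%N%:Z + (k%:Z * - ((degp f)%:Z - (degp g)%:Z)
  + X * - (q ^ r)%N%:Z))
   - (k%:Z * ((degp f)%:Z - (degp g)%:Z) + (q ^ r)%N%:Z * (j%:Z + X)) =
   (q ^ r)%N%:Z * ((degp u)%:Z - j%:Z) by ring.
by rewrite mulr_ge0 // subr_ge0.
Qed.

(** One inclusion is the computation of the values of a monomial at all the
places.  For the other, write z as a combination of the powers of y.  At Q_i and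
at Q_oo no cancellation occurs, so the bound on z passes to each term, whose
values there are read off its factorization; at all the other places, z being
regular forces the coefficients to have no other denominators than the pg i. *)
Lemma Kspan_eq_RRspace : Kspan S = RRspace G.
Proof.
apply/seteqP; split; last exact: RRspace_sub_Kspan.
by apply: Kspan_sub_RRspace; apply: generators_sub_RRspace.
Qed.
End RiemannRoch.

Theorem theorem3p2
  (* the finite field K with q ^ n elements, of characteristic p *)
  (p e q n : nat) (hp : prime p) (he : (0 < e)%N) (hq : q = (p ^ e)%N)
  (hn : (0 < n)%N)
  (K : finFieldType) (hK : #|K| = (q ^ n)%N)
  (* the linearized polynomial L *)
  (r : nat) (lam : 'I_r.+1 -> K)
  (hlam0 : lam ord0 != 0) (hlamr : lam ord_max != 0)
  (hroots : #|[set c : K | root (linearized q lam) c]%SET| = (q ^ r)%N)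
  (* the rational function f / g and the factorizations of f and g *)
  (f g : {poly K}) (hfg : coprimep f g)
  (m : nat) (cf : K) (hcf : cf != 0)
  (qf : 'I_m -> {poly K}) (mf : 'I_m -> nat)
  (hqf : forall j, irreducible_poly (qf j))
  (hqf_distinct : forall j1 j2, j1 != j2 -> ~~ (qf j1 %= qf j2))
  (hmf : forall j, (0 < mf j)%N)
  (hf : f = cf *: \prod_(j < m) qf j ^+ mf j)
  (s : nat) (cg : K) (hcg : cg != 0)
  (pg : 'I_s -> {poly K}) (ng : 'I_s -> nat)
  (hpg : forall i, irreducible_poly (pg i))
  (hpg_distinct : forall i1 i2, i1 != i2 -> ~~ (pg i1 %= pg i2))
  (hng : forall i, (0 < ng i)%N)
  (hg : g = cg *: \prod_(i < s) pg i ^+ ng i)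
  (hd : (degp g < degp f)%N)
  (hng_coprime : forall i, coprime (ng i) p)
  (hd_coprime : coprime (degp f - degp g) p)
  (* the function field F = K(x, y) with L(y) = f(x) / g(x) *)
  (F : fieldExtType {fraction {poly K}}) (y : F)
  (hF : <<1; y>>%VS = fullv)
  (hy : (map_poly (constF F) (linearized q lam)).[y] = polyF F f / polyF F g)
  (* the places Q_1, ..., Q_s, Q_oo and the divisor G *)
  (Q : 'I_s -> place F) (hQ : forall i, is_zero (polyF F (pg i)) (Q i))
  (Qoo : place F) (hQoo : is_pole (xF F) Qoo)
  (a : 'I_s -> int) (boo : int) :
  let G : divisor F := \sum_(i < s) << a i *g Q i >> + << boo *g Qoo >> in
  let S : set F :=
    [set z : F | exists (k : nat) (eoo : int) (ee : 'I_s -> int),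
      [/\ (k <= q ^ r - 1)%N,
          0 <= eoo,
          forall i, - a i <= - (k%:Z * (ng i)%:Z) + (q ^ r)%N%:Z * ee i,
          k%:Z * ((degp f)%:Z - (degp g)%:Z)
            + (q ^ r)%N%:Z * (eoo + \sum_(i < s) ee i * (degp (pg i))%:Z) <= boo
        & z = y ^+ k * xF F ^ eoo * \prod_(i < s) polyF F (pg i) ^ ee i]]%classic
  in Kspan S = RRspace G.
Proof.
have q_gt1 : (1 < q)%N by rewrite hq -(expn0 p) ltn_exp2l // prime_gt1.
have pK : p \in [pchar K] by apply: (@card_finPcharP _ _ (e * n)); rewrite // expnM -hq.
have q_pchar : [pchar K].-nat q.
  by rewrite hq pnatX (eq_pnat _ (pcharf_eq pK)) pnat_id.
have ng_q i : coprime (ng i) q by rewrite hq coprimeXr.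
have d_q : coprime (degp f - degp g) q by rewrite hq coprimeXr.
exact: (Kspan_eq_RRspace q_gt1 q_pchar hlam0 hlamr hroots hfg hcg hpg
  hpg_distinct hng hg hd ng_q d_q hF hy hQ hQoo a boo).
Qed.
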